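(* Assume bounded expectation and flatness (as defined in the context). For $\tau\in\mathbb R\setminus\operatorname{supp}\varrho$ the integrated self-consistent density of states satisfies $$\int_{-\infty}^\tau\varrho(x)\,\mathrm dx=\frac1N\big|\operatorname{Spec}(M(\tau))\cap(-\infty,0)\big|.$$ In particular, $N\int_{-\infty}^\tau\varrho(x)\,\mathrm dx$ is an integer.
   Context: Let $A=A^*\in\mathbb C^{N\times N}$ be deterministic and $\mathcal S[R]=\mathbb E\,WRW$ for $R\in\mathbb C^{N\times N}$, where $W=W^*\in\mathbb C^{N\times N}$ is a random matrix with $\mathbb EW=0$ and finite second moments (real symmetric or complex Hermitian). $\|R\|$ is the operator norm, $\langle R\rangle=N^{-1}\operatorname{Tr}R$, $\mathbb H=\{z\in\mathbb C:\Im z>0\}$. $M=M(z)$, $z\in\mathbb H$, is the unique solution of the Matrix Dyson Equation $1+(z-A+\mathcal S[M])M=0$ with $\Im M=(M-M^* )/(2\mathrm i)>0$. Assumptions: *bounded expectation*, $\|A\|\le C$; *flatness*, $c\langle T\rangle\le\mathcal S[T]\le C\langle T\rangle$ for every positive semidefinite $T$, with constants $0<c<C$. Set $\varrho(z)=\pi^{-1}\Im\langle M(z)\rangle$ for $z\in\mathbb H$ and $\varrho(\tau)=\lim_{\eta\searrow0}\varrho(\tau+\mathrm i\eta)$ for $\tau\in\mathbb R$ (the self-consistent density of states; the limit exists, $\varrho$ is continuous and is a compactly supported probability density). $\operatorname{supp}\varrho$ is its support. $M$ is the Stieltjes transform of a matrix-valued measure supported on $\operatorname{supp}\varrho$, hence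 extends analytically to $\mathbb C\setminus\operatorname{supp}\varrho$; $M(\tau)$ denotes the value of this extension at $\tau\in\mathbb R\setminus\operatorname{supp}\varrho$, a self-adjoint matrix. Its eigenvalues are counted with multiplicity. *)

(* Defs.v *)
From mathcomp Require Export all_boot all_order all_algebra.
From mathcomp Require Export sesquilinear spectral complex.
From mathcomp Require Export all_classical all_reals all_analysis.

Set Implicit Arguments.
Unset Strict Implicit.
Unset Printing Implicit Defensive.
Export Order.TTheory GRing.Theory Num.Theory.
Export numFieldNormedType.Exports.
Open Scope classical_set_scope.
Open Scope ring_scope.
Open Scope sesquilinear_scope.
Open Scope complex_scope.

Section matrices.
Context {R : realType} {N : nat}.
Implicit Types (A B T X : 'M[R[i]]_N) (v : 'cV[R[i]]_N).

(* [0 <= z] in [R[i]] says that [z] is real and nonnegative. *)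
Definition psdmx T := T \is hermsymmx /\ forall v, 0 <= (v^t* *m T *m v) 0 0.

Definition posdefmx T :=
  T \is hermsymmx /\ forall v, v != 0 -> 0 < (v^t* *m T *m v) 0 0.

Definition loewner_le A B := psdmx (B - A).

Definition vnorm v : R :=
  Num.sqrt (\sum_i (complex.Re (v i 0) ^+ 2 + complex.Im (v i 0) ^+ 2)).

Definition opnorm X : R := sup [set vnorm (X *m v) | v in [set v | vnorm v <= 1]].

Definition ntrace X : R[i] := N%:R^-1 * \tr X.

Definition immx X : 'M[R[i]]_N := (2 * 'i)^-1 *: (X - X^t*).

(* The roots of the characteristic polynomial, with multiplicity. *)
Definition spectrum X : seq R[i] := sval (closed_field_poly_normal (char_poly X)).

(* [x < 0] in [R[i]] says that [x] is real and negative. *)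
Definition num_neg_eigenvalues X : nat := count (fun x => x < 0) (spectrum X).

End matrices.

Section self_energy.
Context {R : realType} {d : measure_display} {Omega : measurableType d}.
Variable P : probability Omega R.

Definition cexpectation (X : Omega -> R[i]) : R[i] :=
  fine 'E_P[fun w => complex.Re (X w)] +i* fine 'E_P[fun w => complex.Im (X w)].

Definition mxexpectation {N : nat} (X : Omega -> 'M[R[i]]_N) : 'M[R[i]]_N :=
  \matrix_(i, j) cexpectation (fun w => X w i j).

Definition square_integrable_mx {N : nat} (X : Omega -> 'M[R[i]]_N) :=
  forall i j, (fun w => complex.Re (X w i j)) \in Lfun P 2%:E /\
              (fun w => complex.Im (X w i j)) \in Lfun P 2%:E.

Definition self_energy {N : nat} (W : Omega -> 'M[R[i]]_N) (X : 'M[R[i]]_N) :=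
  mxexpectation (fun w => W w *m X *m W w).

End self_energy.

Section dyson.
Context {R : realType} {N : nat}.
Implicit Types (A X : 'M[R[i]]_N) (S : 'M[R[i]]_N -> 'M[R[i]]_N).

Definition flat S (c C : R) :=
  forall T, psdmx T ->
    loewner_le ((c%:C * ntrace T)%:M) (S T) /\
    loewner_le (S T) ((C%:C * ntrace T)%:M).

Definition mde_solution A S (z : R[i]) X :=
  1%:M + (z%:M - A + S X) *m X = 0 /\ posdefmx (immx X).

Implicit Type M : R[i] -> 'M[R[i]]_N.

Definition scdos_upper M (z : R[i]) : R := pi^-1 * complex.Im (ntrace (M z)).

(* [lim] is total; for the solution of a flat Dyson equation the limit exists. *)
Definition scdos M (tau : R) : R :=
  lim (scdos_upper M (tau +i* eta) @[eta --> 0^'+]).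

Definition supp (f : R -> R) : set R := closure [set x | f x != 0].

Definition off_real (K : set R) : set R[i] := ~` [set x%:C | x in K].

(* Complex differentiability of every entry; [R[i]^o] is [R[i]] seen as a
   normed space over itself, so the increments are complex. *)
Definition holomorphic_mx (D : set R[i]) M :=
  forall z, D z -> forall i j,
    derivable (fun w : R[i]^o => M w i j : R[i]^o) z 1.

Definition analytic_extension M (Mext : R[i] -> 'M[R[i]]_N) :=
  holomorphic_mx (off_real (supp (scdos M))) Mext /\
  (forall z, 0 < complex.Im z -> Mext z = M z).

End dyson.

(* Main.v *)
Require Import Defs.
From mathcomp Require Import ring lra measurable_realfun.
Set Implicit Arguments.
Unset Strict Implicit.
Unset Printing Implicit Defensive.

(** Write S for the self-energy.  The Dyson equation reads
    [M^-1 = A - z - S[M]], and S is self-adjoint for the pairing [tr (X Y)];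
    differentiating therefore gives the exact identity
      [tr M dz = d (log det M - tr (S[M] M) / 2)].
    On a horizontal line in the upper half-plane the imaginary part of the left
    side is [pi N] times the smoothed density, so the density integrates to the
    increment of [arg det M - Im tr (S[M] M) / 2].  As the line descends to the
    real axis, [M] becomes self-adjoint at both ends, which kills the second
    term, and what is left is the increment of [arg det M].

    The branch of [arg det M] has to be followed without ambiguity.  Gaussian
    elimination writes the determinant as the product of its pivots, and when
    the numerical range of a matrix lies in the upper half-plane so do all its
    pivots (numrange_diag, numrange_schur); [argsum] adds the arguments, in
    (0, pi), of the pivots, and its derivative is [Im tr (M^-1 M')]
    (argsum_deriv).  To read off its limit at tau, [M] is first conjugated by
    the unitary matrix that diagonalizes the self-adjoint matrix [M(tau)]: the
    pivots then tend to the eigenvalues, each negative one contributing pi and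
    each positive one 0 (potential_right).  Far to the left of the spectrum
    [Im M <= eps Re M] with [eps] proportional to [Im z], and the same holds for
    every pivot, so the limit is 0 (left_end).

    Passing to the limit under the integral uses two facts.  Flatness turns
    [Im M = M^* (Im z + S[Im M]) M] into the bound [tr (M^* M) <= N / c], which
    gives domination.  Pointwise convergence of the density at each real x is
    the intermediate value theorem against uniqueness: if the smoothed density
    had two cluster values at x, every intermediate value would be attained
    arbitrarily close to x, and a limit point of the corresponding matrices
    would solve the Dyson equation at x with positive definite imaginary part
    and that density; but there is only one such solution (dyson_real_unique).

    Uniqueness: two solutions satisfy [D = M1 S[D] M2] for [D = M1 - M2].  The
    map [X |-> M1 S[X] M2] is a contraction in a norm weighted by the imaginary
    parts.  It has a nonzero fixed point only in the equality case, which is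
    analysed through a Kraus decomposition of S: flatness makes the Kraus
    operators act irreducibly, and a Schur lemma argument forces [M2 = M1^*]
    (kraus_intertwiner), against the positivity of both imaginary parts. *)

Local Notation Re := complex.Re.
Local Notation Im := complex.Im.

(** * Quadratic forms and positive matrices *)

Section QuadraticForms.
Context {C : numClosedFieldType}.

Lemma adjM m n p (A : 'M[C]_(m, n)) (B : 'M[C]_(n, p)) :
  (A *m B)^t* = B^t* *m A^t*.
Proof. by rewrite trmx_mul map_mxM. Qed.

Lemma adjD m n (A B : 'M[C]_(m, n)) : (A + B)^t* = A^t* + B^t*.
Proof. by rewrite linearD /= map_mxD. Qed.

Lemma adjN m n (A : 'M[C]_(m, n)) : (- A)^t* = - A^t*.
Proof. by rewrite linearN /= map_mxN. Qed.

Lemma adjZ m n (a : C) (A : 'M[C]_(m, n)) : (a *: A)^t* = Num.conj a *: A^t*.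
Proof. by rewrite linearZ /= map_mxZ. Qed.

Lemma adj_sum m n (I : finType) (A : I -> 'M[C]_(m, n)) :
  (\sum_i A i)^t* = \sum_i (A i)^t*.
Proof. by rewrite raddf_sum /= map_mx_sum. Qed.

Lemma adj_scalar n (a : C) : (a%:M : 'M[C]_n)^t* = (Num.conj a)%:M.
Proof. by rewrite tr_scalar_mx map_scalar_mx. Qed.

Lemma adj0 m n : (0 : 'M[C]_(m, n))^t* = 0.
Proof. by rewrite trmx0 map_mx0. Qed.

Lemma adj_inj m n : injective (fun A : 'M[C]_(m, n) => A^t*).
Proof. by move=> A B AB; rewrite -[A]trmxCK AB trmxCK. Qed.

Lemma adj_eq0 m n (A : 'M[C]_(m, n)) : A^t* = 0 -> A = 0.
Proof. by move=> A0; apply: adj_inj; rewrite adj0. Qed.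

Lemma hermP n (A : 'M[C]_n) : reflect (A^t* = A) (A \is hermsymmx).
Proof.
apply: (iffP (is_hermitianmxP _ _ _)); rewrite expr0 scale1r; exact: esym.
Qed.

Definition qform n (T : 'M[C]_n) (v : 'cV[C]_n) : C := (v^t* *m T *m v) 0 0.

Lemma qformD n (S T : 'M[C]_n) v : qform (S + T) v = qform S v + qform T v.
Proof. by rewrite /qform mulmxDr mulmxDl mxE. Qed.

Lemma qformN n (T : 'M[C]_n) v : qform (- T) v = - qform T v.
Proof. by rewrite /qform mulmxN mulNmx mxE. Qed.

Lemma qformZ n a (T : 'M[C]_n) v : qform (a *: T) v = a * qform T v.
Proof. by rewrite /qform -scalemxAr -scalemxAl mxE. Qed.

Lemma qform_sum n (I : finType) (T : I -> 'M[C]_n) v :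
  qform (\sum_i T i) v = \sum_i qform (T i) v.
Proof. by rewrite /qform mulmx_sumr mulmx_suml summxE. Qed.

Lemma qform_congr m n (B : 'M[C]_(m, n)) (T : 'M[C]_m) v :
  qform (B^t* *m T *m B) v = qform T (B *m v).
Proof. by rewrite /qform adjM !mulmxA. Qed.

Lemma qform_adj n (T : 'M[C]_n) v : qform (T^t*) v = Num.conj (qform T v).
Proof.
rewrite /qform.
have -> : (v^t* *m T^t* *m v) = (v^t* *m T *m v)^t*.
  by rewrite !adjM trmxCK mulmxA.
by rewrite !mxE.
Qed.

Definition sqnorm n (v : 'cV[C]_n) : C := (v^t* *m v) 0 0.

Lemma sqnormE n (v : 'cV[C]_n) : sqnorm v = \sum_i `|v i 0| ^+ 2.
Proof.
rewrite /sqnorm mxE; apply: eq_bigr => i _.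
by rewrite !mxE normCK mulrC.
Qed.

Lemma sqnorm_ge0 n (v : 'cV[C]_n) : 0 <= sqnorm v.
Proof. by rewrite sqnormE sumr_ge0 // => i _; rewrite exprn_ge0. Qed.

Lemma sqnorm_eq0 n (v : 'cV[C]_n) : sqnorm v = 0 -> v = 0.
Proof.
rewrite sqnormE => /eqP; rewrite psumr_eq0 => [/allP h|i _]; last first.
  by rewrite exprn_ge0.
apply/matrixP => i j; rewrite ord1 mxE.
by move: (h i (mem_index_enum _)); rewrite /= expf_eq0 /= normr_eq0 => /eqP.
Qed.

Lemma sqnorm_gt0 n (v : 'cV[C]_n) : v != 0 -> 0 < sqnorm v.
Proof.
move=> v0; rewrite lt_neqAle sqnorm_ge0 andbT eq_sym.
by apply: contra v0 => /eqP /sqnorm_eq0 ->.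
Qed.

Lemma qform_scalar n (a : C) (v : 'cV[C]_n) : qform a%:M v = a * sqnorm v.
Proof. by rewrite /qform mul_mx_scalar -scalemxAl mxE. Qed.

Lemma qform_gram m n (B : 'M[C]_(m, n)) v : qform (B^t* *m B) v = sqnorm (B *m v).
Proof. by rewrite /qform /sqnorm adjM !mulmxA. Qed.

Lemma qform_delta n (T : 'M[C]_n) i : qform T (delta_mx i 0) = T i i.
Proof.
rewrite /qform trmx_delta map_delta_mx.
by rewrite -rowE -colE !mxE.
Qed.

Lemma qform_diag n (D : 'rV[C]_n) v :
  qform (diag_mx D) v = \sum_j D 0 j * `|v j 0| ^+ 2.
Proof.
rewrite /qform -mulmxA mul_diag_mx mxE; apply: eq_bigr => j _.
by rewrite !mxE /= normCK mulrCA (mulrC (v j 0)).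
Qed.

Lemma mxtrace_qform n (T : 'M[C]_n) : \tr T = \sum_i qform T (delta_mx i 0).
Proof. by apply: eq_bigr => i _; rewrite qform_delta. Qed.

Lemma mx_choice m n (Q : 'I_m -> 'I_n -> C -> Prop) :
  (forall i j, exists l, Q i j l) ->
  exists X : 'M[C]_(m, n), forall i j, Q i j (X i j).
Proof.
move=> h; have /choice[f hf] : forall ij : 'I_m * 'I_n, exists l, Q ij.1 ij.2 l.
  by case.
by exists (\matrix_(i, j) f (i, j)) => i j; rewrite mxE; exact: (hf (i, j)).
Qed.

Lemma mulmx_ext m n (A B : 'M[C]_(m, n)) :
  (forall v : 'cV_n, A *m v = B *m v) -> A = B.
Proof.
move=> AB; apply/matrixP => i j.
by have := AB (delta_mx j 0); rewrite -!colE => /matrixP /(_ i 0); rewrite !mxE.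
Qed.

Lemma unitmx_inj n (X : 'M[C]_n) :
  (forall v : 'cV_n, X *m v = 0 -> v = 0) -> X \in unitmx.
Proof.
move=> X0; rewrite -unitmx_tr -row_free_unit; apply/inj_row_free => v.
move=> /(congr1 trmx); rewrite trmx_mul trmxK trmx0 => /X0 v0.
by rewrite -[v]trmxK v0 trmx0.
Qed.

Lemma delta_neq0 n (i : 'I_n) : delta_mx i 0 != 0 :> 'cV[C]_n.
Proof.
apply/eqP => /matrixP/(_ i 0); rewrite !mxE !eqxx => /eqP.
by rewrite oner_eq0.
Qed.

Lemma sqnorm_sub n (X : 'M[C]_n) k v :
  sqnorm (v - k *: (X *m v)) = sqnorm v - k * qform X v
    - Num.conj (k * qform X v) + `|k| ^+ 2 * sqnorm (X *m v).
Proof.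
rewrite rmorphM /= -qform_adj normCK /sqnorm adjD adjN adjZ /qform.
rewrite mulmxBl !mulmxBr -!scalemxAl -!scalemxAr adjM !mulmxA !mxE; ring.
Qed.

Definition psd n (T : 'M[C]_n) := forall v, 0 <= qform T v.
Definition pd n (T : 'M[C]_n) := forall v, v != 0 -> 0 < qform T v.

Lemma pd_psd n (T : 'M[C]_n) : pd T -> psd T.
Proof.
move=> pT v; have [->|v0] := eqVneq v 0; last exact/ltW/pT.
by rewrite /qform mulmx0 mxE.
Qed.

Lemma pd_unit n (T : 'M[C]_n) : pd T -> T \in unitmx.
Proof.
move=> pT; apply: unitmx_inj => v Tv; apply/eqP/negPn/negP => /pT.
by rewrite /qform -mulmxA Tv mulmx0 mxE ltxx.
Qed.

Lemma spectral_hermitian n (T : 'M[C]_n) : T^t* = T ->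
  exists (P : 'M[C]_n) (D : 'rV[C]_n),
    [/\ P *m P^t* = 1%:M, P^t* *m P = 1%:M, D \is a mxOver Num.real &
        T = P^t* *m diag_mx D *m P].
Proof.
move=> /hermP hT; exists (spectralmx T), (spectral_diag T).
have PU := spectral_unitarymx T.
have PI : spectralmx T *m (spectralmx T)^t* = 1%:M by apply/unitarymxP.
split => //; first exact: mulmx1C.
- exact: hermitian_spectral_diag_real.
- rewrite -invmx_unitary //.
  exact/orthomx_spectralP/hermitian_normalmx.
Qed.

Lemma psd_gram n (T : 'M[C]_n) : T^t* = T -> psd T ->
  exists B : 'M[C]_n, T = B^t* *m B.
Proof.
move=> hT pT; have [P [D [PP _ Dr TE]]] := spectral_hermitian hT.
have D0 i : 0 <= D 0 i.
  have -> : D 0 i = qform (diag_mx D) (delta_mx i 0).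
    by rewrite qform_delta !mxE eqxx mulr1n.
  have -> : diag_mx D = P *m T *m P^t*.
    by rewrite TE !mulmxA PP mul1mx -mulmxA PP mulmx1.
  by rewrite -{1}[P]trmxCK qform_congr.
exists (diag_mx (map_mx sqrtC D) *m P).
rewrite adjM tr_diag_mx map_diag_mx !mulmxA -(mulmxA (P^t*)) mulmx_diag.
rewrite TE; congr (_ *m diag_mx _ *m _); apply/rowP => i; rewrite !mxE.
rewrite /=; have /CrealP -> : sqrtC (D 0 i) \is Num.real by rewrite ger0_real // sqrtC_ge0.
by rewrite -expr2 sqrtCK.
Qed.

Lemma psd_null n (T : 'M[C]_n) v : T^t* = T -> psd T ->
  qform T v = 0 -> T *m v = 0.
Proof.
move=> hT pT; have [B ->] := psd_gram hT pT.
by rewrite qform_gram -mulmxA => /sqnorm_eq0 ->; rewrite mulmx0.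
Qed.

Lemma psd_trace_eq0 n (T : 'M[C]_n) : T^t* = T -> psd T -> \tr T = 0 -> T = 0.
Proof.
move=> hT pT; rewrite mxtrace_qform => /eqP; rewrite psumr_eq0 // => /allP h.
apply: mulmx_ext => v; rewrite mul0mx.
have Te i : T *m delta_mx i 0 = 0 :> 'cV_n.
  by apply: psd_null => //; apply/eqP/h/mem_index_enum.
apply/colP => i; rewrite !mxE big1 // => j _.
by have /matrixP/(_ i 0) := Te j; rewrite -colE !mxE => ->; rewrite mul0r.
Qed.

Lemma real_argmax (I : finType) (i0 : I) (f : I -> C) :
  (forall i, f i \is Num.real) -> exists i, forall j, f j <= f i.
Proof.
move=> fr; have [i _ h] := @comparable_arg_maxP _ _ _ i0 xpredT f erefl
  (fun i j _ _ => real_comparable (fr i) (fr j)).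
by exists i => j; apply: h.
Qed.

(** Simultaneous diagonalization of the pencil: [r] is the largest generalized
    eigenvalue of [B1] with respect to [B0], so that [r B0 - B1] touches the
    boundary of the positive cone. *)
Lemma pencil_null n (B0 B1 : 'M[C]_n) x : B0^t* = B0 -> B1^t* = B1 ->
  pd B0 -> 0 < qform B1 x ->
  exists (r : C) (y : 'cV_n),
    [/\ 0 < r, y != 0, psd (r *: B0 - B1) & qform (r *: B0 - B1) y = 0].
Proof.
move=> h0 h1 p0 px.
have [L B0E] := psd_gram h0 (pd_psd p0).
have Lu : L \in unitmx.
  by have := pd_unit p0; rewrite B0E unitmx_mul => /andP[].
set H := (invmx L)^t* *m B1 *m invmx L.
have hH : H^t* = H by rewrite !adjM trmxCK h1 mulmxA.
have B1E : B1 = L^t* *m H *m L.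
  by rewrite /H !mulmxA -adjM mulVmx // adj_scalar conjC1 mul1mx mulmxKV.
have [P [D [PP PP' Dr HE]]] := spectral_hermitian hH.
pose Q := P *m L.
have B0Q : B0 = Q^t* *m Q.
  by rewrite adjM mulmxA -(mulmxA (L^t*)) PP' mulmx1.
have B1Q : B1 = Q^t* *m diag_mx D *m Q by rewrite B1E HE adjM !mulmxA.
have [i0 _|n0] := pickP 'I_n; last first.
  have x0 : x = 0 by apply/colP => i; have := n0 i.
  by move: px; rewrite x0 /qform mulmx0 mxE ltxx.
have [i imax] := real_argmax i0 (fun i => mxOverP Dr 0 i).
have BE v : qform (D 0 i *: B0 - B1) v
    = \sum_j (D 0 i - D 0 j) * `|(Q *m v) j 0| ^+ 2.
  rewrite qformD qformN qformZ B0Q B1Q qform_gram qform_congr sqnormE mulr_sumr.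
  by rewrite qform_diag -sumrB; apply: eq_bigr => j _; rewrite mulrBl.
(* In the coordinates Q v the pencil is diagonal; y is the i-th basis vector there. *)
exists (D 0 i), (invmx Q *m delta_mx i 0).
have Qu : Q \in unitmx.
  by rewrite unitmx_mul Lu andbT; case/mulmx1_unit: PP.
split.
- rewrite real_ltNge ?(mxOverP Dr) //; apply/negP => Di.
  move: px; apply/negP; rewrite -real_leNgt ?real0 //; last first.
    by apply/CrealP; rewrite -qform_adj h1.
  rewrite B1Q qform_congr qform_diag -oppr_ge0 -sumrN sumr_ge0 // => j _.
  by rewrite -mulNr mulr_ge0 ?exprn_ge0 // oppr_ge0 (le_trans (imax j)).
- apply/eqP => /(congr1 (mulmx Q)); rewrite mulKVmx // mulmx0.
  by move=> /matrixP /(_ i 0); rewrite !mxE !eqxx => /eqP; rewrite oner_eq0.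
- move=> v; rewrite BE sumr_ge0 // => j _.
  by rewrite mulr_ge0 ?exprn_ge0 // subr_ge0.
- rewrite BE big1 // => j _; rewrite mulKVmx // !mxE.
  have [->|_] := eqVneq j i; first by rewrite subrr mul0r.
  by rewrite normr0 expr0n mulr0.
Qed.

End QuadraticForms.

(** * Kraus maps and rigidity of intertwiners *)

Section KrausMaps.
Context {C : numClosedFieldType} {N : nat} {K : finType}.
Variable w : K -> 'M[C]_N.

Definition kraus (X : 'M[C]_N) : 'M[C]_N := \sum_k w k *m X *m (w k)^t*.

Definition irreducible_kraus :=
  forall y z : 'cV[C]_N, (forall k, y^t* *m w k *m z = 0) -> y = 0 \/ z = 0.

Hypothesis irr : irreducible_kraus.

(** The analogue of the Schur lemma: an eigenvalue [l] of [G] is transported by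
    the [w k] to [H], and irreducibility upgrades the eigenvector to the whole
    space. *)
Lemma irr_comm_scalar (G H : 'M[C]_N) :
  (forall k, (w k)^t* *m H = G *m (w k)^t*) -> (0 < N)%N ->
  exists l : C, G = l%:M /\ H = l%:M.
Proof.
move=> GH N0; have [l /eigenvalueP[p pG p0]] := eigenvalue_closed G N0.
have HE : H = l%:M.
  apply: mulmx_ext => u; apply/eqP; rewrite -subr_eq0 -mulmxBl; apply/eqP.
  have [|//|/adj_eq0 /eqP] := irr (y := (H - l%:M) *m u) (z := p^t*).
    move=> k; apply: adj_inj; rewrite adj0 !adjM !trmxCK !mulmxA.
    by rewrite mulmxBr mul_mx_scalar -(mulmxA p) GH mulmxA pG -scalemxAl subrr mul0mx.
  by rewrite (negPf p0).
exists l; split => //; apply: adj_inj; apply: mulmx_ext => u.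
apply/eqP; rewrite -subr_eq0 -mulmxBl; apply/eqP.
have p'0 : p^t* <> 0 by move=> /adj_eq0 /eqP; rewrite (negPf p0).
have [k|/p'0//|//] := irr (y := p^t*) (z := (G^t* - (l%:M)^t*) *m u).
apply: adj_inj; rewrite adj0 -adjN -adjD !adjM !trmxCK.
by rewrite mulmxA -(mulmxA (u^t*)) mulmxBl -GH HE scalar_mxC subrr mulmx0 mul0mx.
Qed.

(** The equality case of a contraction.  Since [V1] and [V2] are fixed by
    the two diagonal maps, [X |-> M1 kraus(X) M2] preserves positivity of the
    block matrix with diagonal [V1], [V2] and off-diagonal corner [X].
    Rescaling the fixed point [D] until that block matrix, [T] below, becomes
    singular, its kernel is stable under all the pairs [Yu k], [Yv k]; by
    irreducibility the kernel is the graph of a matrix [G] that intertwines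
    [M1^*] and [M2], and [irr_comm_scalar] makes [G] a scalar. *)
Lemma kraus_intertwiner (M1 M2 V1 V2 D : 'M[C]_N) :
  V1^t* = V1 -> V2^t* = V2 -> pd V1 -> pd V2 ->
  V1 = M1 *m kraus V1 *m M1^t* -> V2 = M2^t* *m kraus V2 *m M2 ->
  D = M1 *m kraus D *m M2 -> D = 0 \/ M2 = M1^t*.
Proof.
move=> hV1 hV2 pV1 pV2 eV1 eV2 eD.
have [->|D0] := eqVneq D 0; [by left|right].
have N0 : (0 < N)%N.
  by rewrite lt0n; apply: contra D0 => /eqP N0; apply/eqP/matrixP => i;
     have := ltn_ord i; rewrite {2}N0.
pose B0 := block_mx V1 0 0 V2; pose B1 := block_mx 0 D (D^t*) 0.
have adj_block (X Y Z W : 'M[C]_N) :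
    (block_mx X Y Z W)^t* = block_mx (X^t*) (Z^t*) (Y^t*) (W^t*).
  by rewrite tr_block_mx map_block_mx.
have adj_col (u v : 'cV[C]_N) : (col_mx u v)^t* = row_mx (u^t*) (v^t*).
  by rewrite tr_col_mx map_row_mx.
have h0 : B0^t* = B0 by rewrite adj_block !adj0 hV1 hV2.
have h1 : B1^t* = B1 by rewrite adj_block !adj0 trmxCK.
have qB0 u v : qform B0 (col_mx u v) = qform V1 u + qform V2 v.
  rewrite /qform adj_col mul_row_block mul_row_col !mulmx0 addr0 add0r.
  by rewrite mxE.
have p0 : pd B0.
  move=> x; rewrite -[x]vsubmxK qB0; move: (usubmx x) (dsubmx x) => u v.
  have [->|u0 _] := eqVneq u 0; last exact: ltr_wpDr (pd_psd pV2 _) (pV1 _ u0).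
  have [->|v0 _] := eqVneq v 0; first by rewrite col_mx0 eqxx.
  exact: ltr_wpDl (pd_psd pV1 _) (pV2 _ v0).
have [j Dj] : exists j, D *m delta_mx j 0 != 0 :> 'cV_N.
  apply/existsP; apply: contraR D0; rewrite negb_exists => /forallP h.
  apply/eqP/matrixP => i j; have := h j; rewrite negbK -colE => /eqP.
  by move=> /matrixP/(_ i 0); rewrite !mxE.
have px : 0 < qform B1 (col_mx (D *m delta_mx j 0) (delta_mx j 0)).
  set e := delta_mx j 0.
  rewrite /qform adj_col mul_row_block mul_row_col !mulmx0 addr0 add0r.
  rewrite adjM -!mulmxA mxE mulmxA -adjM.
  by rewrite addr_gt0 // sqnorm_gt0.
have [r [x [r0 x0 pT qT]]] := pencil_null h0 h1 p0 px.
set T := r *: B0 - B1 in pT qT.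
have TE : T = block_mx (r *: V1) (- D) (- D^t*) (r *: V2).
  rewrite /T scale_block_mx opp_block_mx add_block_mx !scaler0 !oppr0.
  by rewrite !addr0 !add0r.
have hT : T^t* = T.
  rewrite TE adj_block !adjZ !adjN trmxCK hV1 hV2.
  by have /CrealP -> : r \is Num.real by rewrite gtr0_real.
have kerT (u v : 'cV[C]_N) : T *m col_mx u v = 0 <->
    r *: (V1 *m u) = D *m v /\ r *: (V2 *m v) = D^t* *m u.
  rewrite TE mul_block_col !mulNmx -!scalemxAl.
  split => [e|[-> ->]]; last by rewrite subrr addNr col_mx0.
  move/eqP: e; rewrite col_mx_eq0 => /andP[e1 e2].
  by split; apply/eqP; rewrite -subr_eq0 // addrC.
pose b X (u v : 'cV[C]_N) := (u^t* *m X *m v) 0 0.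
have qTE u v : qform T (col_mx u v)
    = r * qform V1 u + r * qform V2 v - b D u v - Num.conj (b D u v).
  have -> : Num.conj (b D u v) = b (D^t*) v u.
    have -> : Num.conj (b D u v) = ((u^t* *m D *m v)^t*) 0 0.
      by rewrite [RHS]mxE [in RHS]mxE.
    by rewrite !adjM trmxCK mulmxA.
  rewrite /b /qform TE adj_col mul_row_block mul_row_col.
  rewrite -!scalemxAr !mulmxN !mulmxDl -!scalemxAl !mulNmx !mxE; ring.
pose Yu k (u : 'cV[C]_N) := (w k)^t* *m (M1^t* *m u).
pose Yv k (v : 'cV[C]_N) := (w k)^t* *m (M2 *m v).
have qY u v : qform T (col_mx u v) = \sum_k qform T (col_mx (Yu k u) (Yv k v)).
  rewrite qTE {1}eV1 {1}eV2 -{1}[M1]trmxCK !qform_congr.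
  rewrite /kraus !qform_sum.
  have -> : b D u v = \sum_k b D (Yu k u) (Yv k v).
    rewrite [in LHS]/b [in LHS]eD /kraus.
    rewrite mulmx_sumr mulmx_suml mulmx_sumr mulmx_suml summxE.
    by apply: eq_bigr => k _; rewrite /b /Yu /Yv !adjM !trmxCK !mulmxA.
  rewrite rmorph_sum /= !mulr_sumr -!sumrN -!big_split /=; apply: eq_bigr => k _.
  by rewrite qTE -!qform_congr !trmxCK.
have kerY u v k : T *m col_mx u v = 0 -> T *m col_mx (Yu k u) (Yv k v) = 0.
  move=> Tuv; apply: psd_null => //; apply/eqP.
  have : qform T (col_mx u v) == 0 by rewrite /qform -mulmxA Tuv mulmx0 mxE.
  by rewrite qY psumr_eq0 // => /allP; apply; rewrite mem_index_enum.
pose G := r^-1 *: (invmx V2 *m D^t*); pose E := r *: V1 - D *m G.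
have rn0 : r != 0 by rewrite gt_eqF.
have V2u := pd_unit pV2.
have kerG (u v : 'cV[C]_N) : T *m col_mx u v = 0 <-> v = G *m u /\ E *m u = 0.
  apply: iff_trans (kerT u v) _; split => [[e1 e2]|[-> e]].
    have vE : v = G *m u.
      rewrite /G -scalemxAl -mulmxA -e2 -scalemxAr scalerA mulVf // scale1r.
      by rewrite mulKmx.
    split => //; rewrite /E mulmxBl -scalemxAl e1 vE.
    by rewrite mulmxA subrr.
  split.
    by apply/eqP; rewrite -subr_eq0 scalemxAl mulmxA -mulmxBl; apply/eqP.
  by rewrite /G -scalemxAl -scalemxAr scalerA divff // scale1r -mulmxA mulKVmx.
have M1u : M1^t* \in unitmx.
  have := pd_unit pV1; rewrite eV1 unitmx_mul => /andP[_ //].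
have [xu0 xE] : usubmx x != 0 /\ E *m usubmx x = 0.
  have := psd_null hT pT qT; rewrite -{1}[x]vsubmxK => /kerG[xv xE]; split => //.
  apply: contra x0 => /eqP xu; rewrite -[x]vsubmxK xv xu.
  by rewrite mulmx0 col_mx0.
(* E is the Schur complement of T: one null vector of E yields a spanning family. *)
have E0 : E = 0.
  apply: adj_inj; rewrite adj0; apply: mulmx_ext => p; rewrite mul0mx.
  have [k|/eqP|//] := irr (y := M1^t* *m usubmx x) (z := E^t* *m p); last first.
    move=> /eqP /(congr1 (mulmx (invmx (M1^t*)))).
    by rewrite mulKmx // mulmx0 => /eqP; rewrite (negPf xu0).
  have xker : T *m col_mx (usubmx x) (G *m usubmx x) = 0 by apply/kerG.
  have /kerG [_ e] := kerY _ _ k xker.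
  by apply: adj_inj; rewrite adj0 !adjM !trmxCK -!mulmxA -/(Yu k _) e mulmx0.
have wG k : (w k)^t* *m (M2 *m G *m invmx (M1^t*)) = G *m (w k)^t*.
  apply: mulmx_ext => u.
  have /(kerY _ _ k)/kerG [] : T *m col_mx (invmx (M1^t*) *m u) (G *m (invmx (M1^t*) *m u)) = 0.
    by apply/kerG; rewrite E0 mul0mx.
  by rewrite /Yu /Yv mulKVmx // !mulmxA => -> _.
have [l [GE HE]] := irr_comm_scalar wG N0.
have l0 : l != 0.
  apply: contra D0 => /eqP l0; apply/eqP; apply: adj_eq0.
  have : V2 *m (r *: G) = 0 by rewrite GE l0 raddf0 scaler0 mulmx0.
  by rewrite /G scalerA divff // scale1r mulKVmx.
have : M2 *m G = l%:M *m M1^t* by rewrite -HE mulmxKV.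
rewrite GE mul_scalar_mx mul_mx_scalar => /(congr1 (fun X => l^-1 *: X)).
by rewrite !scalerA mulVf // !scale1r.
Qed.

End KrausMaps.

(** * The self-energy as a Kraus map *)

Section ReIm.
Context {R : realType}.
Implicit Types a b : R[i].

Lemma ReD a b : Re (a + b) = Re a + Re b. Proof. by case: a; case: b. Qed.
Lemma ImD a b : Im (a + b) = Im a + Im b. Proof. by case: a; case: b. Qed.
Lemma ReN a : Re (- a) = - Re a. Proof. by case: a. Qed.
Lemma ImN a : Im (- a) = - Im a. Proof. by case: a. Qed.
Lemma ReM a b : Re (a * b) = Re a * Re b - Im a * Im b.
Proof. by case: a; case: b. Qed.
Lemma ImM a b : Im (a * b) = Re a * Im b + Im a * Re b.
Proof. by case: a; case: b. Qed.
Lemma ReJ a : Re (Num.conj a) = Re a. Proof. by case: a. Qed.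
Lemma ImJ a : Im (Num.conj a) = - Im a. Proof. by case: a. Qed.

Lemma complexP a b : Re a = Re b -> Im a = Im b -> a = b.
Proof. by case: a => ? ?; case: b => ? ? /= -> ->. Qed.

Lemma Re_sum (I : Type) (r : seq I) (p : pred I) (f : I -> R[i]) :
  Re (\sum_(i <- r | p i) f i) = \sum_(i <- r | p i) Re (f i).
Proof. by apply: (big_morph _ ReD). Qed.

Lemma Im_sum (I : Type) (r : seq I) (p : pred I) (f : I -> R[i]) :
  Im (\sum_(i <- r | p i) f i) = \sum_(i <- r | p i) Im (f i).
Proof. by apply: (big_morph _ ImD). Qed.

Lemma complex_ge0 a : (0 <= a) = (Im a == 0) && (0 <= Re a).
Proof. by rewrite lecE. Qed.

Lemma complex_gt0 a : (0 < a) = (Im a == 0) && (0 < Re a).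
Proof. by rewrite ltcE. Qed.

End ReIm.

Section SelfEnergy.
Context {R : realType} {d : measure_display} {Omega : measurableType d}.
Variable P : probability Omega R.

Let cintegrable (f : Omega -> R[i]) :=
  P.-integrable setT (EFin \o (fun w => Re (f w))) /\
  P.-integrable setT (EFin \o (fun w => Im (f w))).

Lemma cexpectationE (f : Omega -> R[i]) :
  cexpectation P f
  = (\int[P]_w Re (f w)) +i* (\int[P]_w Im (f w)).
Proof. by rewrite /cexpectation unlock. Qed.

Lemma cintegrableD f g : cintegrable f -> cintegrable g ->
  cintegrable (fun w => f w + g w).
Proof.
move=> [f1 f2] [g1 g2]; split.
  by apply: eq_integrable (integrableD measurableT f1 g1) => // w _ /=; rewrite ReD EFinD.
by apply: eq_integrable (integrableD measurableT f2 g2) => // w _ /=; rewrite ImD EFinD.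
Qed.

Lemma cexpectationD f g : cintegrable f -> cintegrable g ->
  cexpectation P (fun w => f w + g w) = cexpectation P f + cexpectation P g.
Proof.
move=> [f1 f2] [g1 g2]; rewrite !cexpectationE; apply: complexP => /=.
  by rewrite -RintegralD //; congr fine; apply: eq_integral => w _; rewrite ReD.
by rewrite -RintegralD //; congr fine; apply: eq_integral => w _; rewrite ImD.
Qed.

Let integrableZ (a b : R) (f g : Omega -> R) :
  P.-integrable setT (EFin \o f) -> P.-integrable setT (EFin \o g) ->
  P.-integrable setT (EFin \o (fun w => a * f w + b * g w)).
Proof.
move=> hf hg.
apply: eq_integrable (integrableD measurableT (integrableZl measurableT a hf)
  (integrableZl measurableT b hg)) => //.
Qed.

Let RintegralL (a b : R) (f g : Omega -> R) :
  P.-integrable setT (EFin \o f) -> P.-integrable setT (EFin \o g) ->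
  \int[P]_w (a * f w + b * g w) = a * (\int[P]_w f w) + b * \int[P]_w g w.
Proof.
move=> hf hg; rewrite RintegralD ?RintegralZl //.
- exact: eq_integrable (integrableZl measurableT a hf).
- exact: eq_integrable (integrableZl measurableT b hg).
Qed.

Lemma cintegrableZ a f : cintegrable f -> cintegrable (fun w => a * f w).
Proof.
move=> [f1 f2]; split.
  apply: eq_integrable (integrableZ (Re a) (- Im a) f1 f2) => // w _ /=.
  by rewrite ReM mulNr.
apply: eq_integrable (integrableZ (Re a) (Im a) f2 f1) => // w _ /=.
by rewrite ImM.
Qed.

Lemma cexpectationZ a f : cintegrable f ->
  cexpectation P (fun w => a * f w) = a * cexpectation P f.
Proof.
move=> [f1 f2]; rewrite !cexpectationE; apply: complexP; rewrite ?ReM ?ImM /=.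
  by rewrite -mulNr -RintegralL //; congr fine; apply: eq_integral => w _;
    rewrite ReM mulNr.
by rewrite -RintegralL //; congr fine; apply: eq_integral => w _; rewrite ImM.
Qed.

Lemma cexpectation0 : cexpectation P (fun=> 0) = 0.
Proof. by rewrite cexpectationE /= !Rintegral_cst // !mul0r. Qed.

Lemma cexpectation_sum (I : Type) (r : seq I) (f : I -> Omega -> R[i]) :
  (forall i, cintegrable (f i)) ->
  cintegrable (fun w => \sum_(i <- r) f i w) /\
  cexpectation P (fun w => \sum_(i <- r) f i w) = \sum_(i <- r) cexpectation P (f i).
Proof.
move=> hf; elim: r => [|i r [IH1 IH2]].
  have -> : (fun w => \sum_(i <- [::]) f i w) = fun=> 0.
    by apply/funext => w; rewrite big_nil.
  rewrite big_nil cexpectation0; split => //.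
  by split; exact: integrable0.
have -> : (fun w => \sum_(j <- i :: r) f j w) = (fun w => f i w + \sum_(j <- r) f j w).
  by apply/funext => w; rewrite big_cons.
by rewrite big_cons cexpectationD // IH2; split => //; exact: cintegrableD.
Qed.

Lemma cexpectationJ f : cintegrable f ->
  cexpectation P (fun w => Num.conj (f w)) = Num.conj (cexpectation P f).
Proof.
move=> [f1 f2]; rewrite !cexpectationE; apply: complexP => /=.
  by congr fine; apply: eq_integral => w _; rewrite ReJ.
rewrite -mulN1r -RintegralZl //; congr fine; apply: eq_integral => w _.
by rewrite ImJ mulN1r.
Qed.

Lemma cexpectation_ge0 f : (forall w, 0 <= f w) -> 0 <= cexpectation P f.
Proof.
move=> f0; rewrite cexpectationE complex_ge0 /=.
have -> : \int[P]_w Im (f w) = \int[P]_w (0 : R).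
  congr fine; apply: eq_integral => w _.
  by have := f0 w; rewrite complex_ge0 => /andP[/eqP -> _].
rewrite Rintegral_cst // mul0r eqxx Rintegral_ge0 // => w _.
by have := f0 w; rewrite complex_ge0 => /andP[].
Qed.

Context {N : nat}.
Variable W : Omega -> 'M[R[i]]_N.
Hypothesis hW : forall w, W w \is hermsymmx.
Hypothesis hW2 : square_integrable_mx P W.

Lemma cintegrable_entries i j k l : cintegrable (fun w => W w i j * W w k l).
Proof.
have [a1 a2] := hW2 i j; have [b1 b2] := hW2 k l.
have I1 f g : f \in Lfun P 2%:E -> g \in Lfun P 2%:E ->
    P.-integrable setT (EFin \o (fun w => f w * g w)).
  by move=> hf hg; apply/Lfun1_integrable; exact: Lfun2_mul_Lfun1.
split.
  apply: eq_integrable (integrableB measurableT (I1 _ _ a1 b1) (I1 _ _ a2 b2)) => // w _ /=.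
  by rewrite ReM EFinB.
apply: eq_integrable (integrableD measurableT (I1 _ _ a1 b2) (I1 _ _ a2 b1)) => // w _ /=.
by rewrite ImM EFinD.
Qed.

Let kappa i a b j := cexpectation P (fun w => W w i a * W w b j).

Lemma self_energyE X i j :
  self_energy P W X i j = \sum_a \sum_b X a b * kappa i a b j.
Proof.
rewrite /self_energy mxE.
have -> : (fun w => (W w *m X *m W w) i j) =
    (fun w => \sum_a \sum_b X a b * (W w i a * W w b j)).
  apply/funext => w; rewrite mxE exchange_big /=; apply: eq_bigr => b _.
  by rewrite mxE mulr_suml; apply: eq_bigr => a _; ring.
have h a b : cintegrable (fun w => X a b * (W w i a * W w b j)).
  exact/cintegrableZ/cintegrable_entries.
have h' a := cexpectation_sum (index_enum _) (h a).
have [_ ->] := cexpectation_sum (index_enum _) (fun a => (h' a).1).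
apply: eq_bigr => a _; rewrite (h' a).2; apply: eq_bigr => b _.
by rewrite cexpectationZ //; exact: cintegrable_entries.
Qed.

(** The two factors of [W w i a * W w b j] commute, which makes the tensor of
    second moments symmetric and the self-energy self-adjoint for the bilinear
    trace pairing. *)
Lemma self_energy_trace X Y :
  \tr (self_energy P W X *m Y) = \tr (X *m self_energy P W Y).
Proof.
rewrite /mxtrace.
transitivity (\sum_i \sum_j \sum_a \sum_b X a b * kappa i a b j * Y j i).
  apply: eq_bigr => i _; rewrite mxE; apply: eq_bigr => j _.
  rewrite self_energyE mulr_suml; apply: eq_bigr => a _.
  by rewrite mulr_suml.
transitivity (\sum_a \sum_b \sum_j \sum_i X a b * kappa i a b j * Y j i).
  under eq_bigr => i _ do rewrite exchange_big /=.
  rewrite exchange_big /=; apply: eq_bigr => a _.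
  under eq_bigr => i _ do rewrite exchange_big /=.
  rewrite exchange_big /=; apply: eq_bigr => b _.
  by rewrite exchange_big.
apply: eq_bigr => a _; rewrite mxE; apply: eq_bigr => b _.
rewrite self_energyE mulr_sumr; apply: eq_bigr => j _.
rewrite mulr_sumr; apply: eq_bigr => i _.
have -> : kappa b j i a = kappa i a b j.
  by congr cexpectation; apply/funext => w; rewrite mulrC.
ring.
Qed.

(** The covariances of the entries of a Hermitian [W] form a positive
    semidefinite matrix indexed by pairs; the rows of a Gram factor of it are
    the Kraus operators. *)
Lemma self_energy_kraus : exists w : 'I_(N * N) -> 'M[R[i]]_N,
  forall X, self_energy P W X = kraus w X.
Proof.
pose V om := mxvec (W om).
have VE om (i j : 'I_N) : V om 0 (mxvec_index i j) = W om i j by rewrite mxvecE.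
have WJ om i j : Num.conj (W om i j) = W om j i.
  by have /hermP/matrixP/(_ j i) := hW om; rewrite !mxE.
have Vint p q : cintegrable (fun om => V om 0 p * Num.conj (V om 0 q)).
  case/mxvec_indexP: p => i a; case/mxvec_indexP: q => j b.
  have -> : (fun om => V om 0 (mxvec_index i a) * Num.conj (V om 0 (mxvec_index j b)))
    = (fun om => W om i a * W om b j) by apply/funext => om; rewrite !VE WJ.
  exact: cintegrable_entries.
pose G : 'M[R[i]]_(N * N) := \matrix_(p, q)
  cexpectation P (fun om => V om 0 p * Num.conj (V om 0 q)).
have hG : G^t* = G.
  apply/matrixP => p q; rewrite !mxE /= -cexpectationJ //; congr cexpectation.
  by apply/funext => om; rewrite rmorphM /= conjCK mulrC.
have pG : psd G.
  move=> v; rewrite /qform -mulmxA mxE.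
  have -> : \sum_p v^t* 0 p * (G *m v) p 0 = cexpectation P (fun om =>
      \sum_p \sum_q (Num.conj (v p 0) * v q 0) * (V om 0 p * Num.conj (V om 0 q))).
    have h p q : cintegrable (fun om =>
        (Num.conj (v p 0) * v q 0) * (V om 0 p * Num.conj (V om 0 q))).
      exact: cintegrableZ.
    have h' p := cexpectation_sum (index_enum _) (h p).
    have [_ ->] := cexpectation_sum (index_enum _) (fun a => (h' a).1).
    apply: eq_bigr => p _; rewrite (h' p).2 [(G *m v) p 0]mxE mulr_sumr; apply: eq_bigr => q _.
    by rewrite cexpectationZ // !mxE /=; ring.
  apply: cexpectation_ge0 => om.
  have -> : \sum_p \sum_q (Num.conj (v p 0) * v q 0) * (V om 0 p * Num.conj (V om 0 q))
     = `|\sum_p Num.conj (v p 0) * V om 0 p| ^+ 2.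
    rewrite normCK rmorph_sum /= mulr_suml; apply: eq_bigr => p _.
    rewrite mulr_sumr; apply: eq_bigr => q _.
    by rewrite rmorphM /= conjCK; ring.
  exact: exprn_ge0.
have [B GB] := psd_gram hG pG.
exists (fun k => \matrix_(i, a) Num.conj (B k (mxvec_index i a))) => X.
apply/matrixP => i j; rewrite self_energyE /kraus summxE.
transitivity (\sum_a \sum_b \sum_k X a b *
    (Num.conj (B k (mxvec_index i a)) * B k (mxvec_index j b))).
  apply: eq_bigr => a _; apply: eq_bigr => b _; rewrite -mulr_sumr; congr (_ * _).
  have -> : kappa i a b j = G (mxvec_index i a) (mxvec_index j b).
    by rewrite mxE; congr cexpectation; apply/funext => om; rewrite !VE WJ.
  by rewrite GB mxE; apply: eq_bigr => k _; rewrite !mxE.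
under eq_bigr => a _ do rewrite exchange_big /=.
rewrite exchange_big /=; apply: eq_bigr => k _.
rewrite exchange_big mxE /=; apply: eq_bigr => b _.
rewrite mxE mulr_suml; apply: eq_bigr => a _.
by rewrite !mxE /= conjCK; ring.
Qed.

End SelfEnergy.

(** * The Dyson equation: a priori bounds *)

Section EntryNorm.
Context {C : numClosedFieldType}.

(** The sum of the moduli of the entries is the most convenient norm here: it is
    submultiplicative by mere reordering, and dominates quadratic forms. *)
Definition l1norm m n (X : 'M[C]_(m, n)) : C := \sum_i \sum_j `|X i j|.

Lemma l1norm_ge0 m n (X : 'M[C]_(m, n)) : 0 <= l1norm X.
Proof. by apply: sumr_ge0 => i _; apply: sumr_ge0 => j _. Qed.

Lemma l1normM m n p (X : 'M[C]_(m, n)) (Y : 'M[C]_(n, p)) :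
  l1norm (X *m Y) <= l1norm X * l1norm Y.
Proof.
apply: (@le_trans _ _ (\sum_i \sum_j \sum_k `|X i k| * `|Y k j|)).
  apply: ler_sum => i _; apply: ler_sum => j _; rewrite mxE.
  by apply: le_trans (ler_norm_sum _ _ _) _; apply: ler_sum => k _; rewrite normrM.
rewrite /l1norm mulr_suml; apply: ler_sum => i _; rewrite exchange_big /=.
rewrite mulr_suml; apply: ler_sum => k _; rewrite -mulr_sumr.
rewrite ler_wpM2l // (bigD1 k) //= lerDl.
by apply: sumr_ge0 => ? _; apply: sumr_ge0.
Qed.

Lemma l1norm_sum m n (I : finType) (F : I -> 'M[C]_(m, n)) :
  l1norm (\sum_k F k) <= \sum_k l1norm (F k).
Proof.
rewrite /l1norm [leRHS]exchange_big /=; apply: ler_sum => i _.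
rewrite [leRHS]exchange_big /=; apply: ler_sum => j _.
by rewrite summxE; exact: ler_norm_sum.
Qed.

Lemma l1norm_adj m n (X : 'M[C]_(m, n)) : l1norm (X^t*) = l1norm X.
Proof.
rewrite /l1norm exchange_big; apply: eq_bigr => i _; apply: eq_bigr => j _.
by rewrite !mxE norm_conjC.
Qed.

Lemma l1norm_kraus n (K : finType) (w : K -> 'M[C]_n) X :
  l1norm (kraus w X) <= (\sum_k l1norm (w k) ^+ 2) * l1norm X.
Proof.
apply: le_trans (l1norm_sum _) _; rewrite mulr_suml; apply: ler_sum => k _.
apply: le_trans (l1normM _ _) _; rewrite l1norm_adj expr2 mulrAC.
by rewrite ler_wpM2r ?l1norm_ge0 // l1normM.
Qed.

Lemma norm_qform_le n (X : 'M[C]_n) v : `|qform X v| <= l1norm X * sqnorm v.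
Proof.
have nv i : `|v i 0| <= sqrtC (sqnorm v).
  rewrite -[leLHS]sqrCK // ler_sqrtC ?qualifE /= ?exprn_ge0 ?sqnorm_ge0 //.
  by rewrite sqnormE (bigD1 i) //= lerDl sumr_ge0 // => ? _; rewrite exprn_ge0.
rewrite /qform -mulmxA mxE; apply: le_trans (ler_norm_sum _ _ _) _.
rewrite /l1norm mulr_suml; apply: ler_sum => i _.
rewrite !mxE normrM /= norm_conjC mulr_suml.
apply: (@le_trans _ _ (`|v i 0| * \sum_j `|X i j| * `|v j 0|)).
  rewrite ler_wpM2l //; apply: le_trans (ler_norm_sum _ _ _) _.
  by apply: ler_sum => j _; rewrite normrM.
rewrite mulr_sumr; apply: ler_sum => j _; rewrite mulrCA ler_wpM2l //.
by rewrite -[sqnorm v]sqrtCK expr2 ler_pM.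
Qed.

End EntryNorm.

Section Kraus.
Context {C : numClosedFieldType} {N : nat} {K : finType}.
Variable w : K -> 'M[C]_N.

Lemma krausD X Y : kraus w (X + Y) = kraus w X + kraus w Y.
Proof.
by rewrite /kraus -big_split; apply: eq_bigr => k _; rewrite mulmxDr mulmxDl.
Qed.

Lemma krausZ a X : kraus w (a *: X) = a *: kraus w X.
Proof.
rewrite /kraus scaler_sumr; apply: eq_bigr => k _.
by rewrite -scalemxAr -scalemxAl.
Qed.

Lemma krausB X Y : kraus w (X - Y) = kraus w X - kraus w Y.
Proof. by rewrite krausD -scaleN1r krausZ scaleN1r. Qed.

Lemma kraus_adj X : (kraus w X)^t* = kraus w (X^t*).
Proof.
by rewrite /kraus adj_sum; apply: eq_bigr => k _; rewrite !adjM trmxCK mulmxA.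
Qed.

End Kraus.

Section ImaginaryPart.
Context {R : realType} {N : nat}.
Implicit Types X : 'M[R[i]]_N.

Lemma conj_inv2i : Num.conj ((2 * 'i)^-1 : R[i]) = - (2 * 'i)^-1.
Proof. by rewrite fmorphV rmorphM /= conjC_nat; apply: complexP => /=; field. Qed.

Lemma immx_adj X : (immx X)^t* = immx X.
Proof.
by rewrite /immx adjZ adjD adjN trmxCK conj_inv2i scaleNr -scalerN opprB.
Qed.

Lemma qform_immx X v : qform (immx X) v = (Im (qform X v))%:C.
Proof.
rewrite /immx qformZ qformD qformN qform_adj.
by case: (qform X v) => a b; apply: complexP => /=; field.
Qed.

Lemma trace_immx X : \tr (immx X) = (Im (\tr X))%:C.
Proof.
rewrite !mxtrace_qform Im_sum rmorph_sum /=; apply: eq_bigr => i _.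
exact: qform_immx.
Qed.

Lemma immx_conj X (B : 'M[R[i]]_N) : immx (B^t* *m X *m B) = B^t* *m immx X *m B.
Proof.
rewrite /immx -scalemxAr -scalemxAl; congr (_ *: _).
by rewrite !adjM trmxCK mulmxBr mulmxBl mulmxA.
Qed.

End ImaginaryPart.

Section Dyson.
Context {R : realType} {N : nat} {K : finType}.
Variables (w : K -> 'M[R[i]]_N) (A : 'M[R[i]]_N) (c C : R).
Hypothesis hN : (0 < N)%N.
Hypothesis hA : A^t* = A.
Hypothesis hc : 0 < c.
Hypothesis hC : 0 < C.
Let S := kraus w.
Hypothesis hflat : flat S c C.
Implicit Types (X M T V : 'M[R[i]]_N) (v : 'cV[R[i]]_N) (z : R[i]).

Definition nsq n (v : 'cV[R[i]]_n) : R := Re (sqnorm v).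

Lemma sqnorm_nsq n (v : 'cV[R[i]]_n) : sqnorm v = (nsq v)%:C.
Proof.
have := sqnorm_ge0 v; rewrite complex_ge0 => /andP[/eqP h _].
by apply: complexP.
Qed.

Lemma nsq_ge0 n (v : 'cV[R[i]]_n) : 0 <= nsq v.
Proof. by have := sqnorm_ge0 v; rewrite complex_ge0 => /andP[]. Qed.

Lemma nsqE n (v : 'cV[R[i]]_n) : nsq v = \sum_i (Re (v i 0) ^+ 2 + Im (v i 0) ^+ 2).
Proof.
rewrite /nsq sqnormE Re_sum; apply: eq_bigr => i _.
by rewrite -add_Re2_Im2.
Qed.

Lemma nsq_delta i : nsq (delta_mx i 0 : 'cV[R[i]]_N) = 1.
Proof.
rewrite nsqE (bigD1 i) //= big1 => [|j ji]; rewrite !mxE ?eqxx /=.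
  by rewrite expr1n expr0n /= !addr0.
by rewrite (negPf ji) /= expr0n /= addr0.
Qed.

Lemma ntrace_Re T : Re (ntrace T) = N%:R^-1 * Re (\tr T).
Proof.
rewrite /ntrace; have -> : (N%:R : R[i]) = (N%:R : R)%:C by rewrite rmorph_nat.
by rewrite -fmorphV ReM /= mul0r subr0.
Qed.

Lemma posdefmx_psdmx (V : 'M[R[i]]_N) : posdefmx V -> psdmx V.
Proof.
by move=> [hV pV]; split => //; exact: pd_psd.
Qed.

Lemma posdefmx_trace (V : 'M[R[i]]_N) : posdefmx V -> 0 < Re (\tr V).
Proof.
move=> pV; rewrite mxtrace_qform Re_sum (bigD1 (Ordinal hN)) //=.
apply: ltr_wpDr.
  apply: sumr_ge0 => i _.
  by have := (posdefmx_psdmx pV).2 (delta_mx i 0); rewrite complex_ge0 => /andP[].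
by have := pV.2 _ (delta_neq0 (Ordinal hN)); rewrite complex_gt0 => /andP[].
Qed.

Lemma flat_lower T v : psdmx T ->
  c * Re (ntrace T) * nsq v <= Re (qform (S T) v).
Proof.
move=> /hflat[[_ hl] _].
have : 0 <= qform (S T - (c%:C * ntrace T)%:M) v := hl v.
rewrite qformD qformN qform_scalar complex_ge0 => /andP[_].
rewrite sqnorm_nsq ReD ReN !ReM /= !mul0r !subr0 mulr0 subr0.
by rewrite subr_ge0.
Qed.

Lemma flat_upper T v : psdmx T ->
  Re (qform (S T) v) <= C * Re (ntrace T) * nsq v.
Proof.
move=> /hflat[_ [_ hu]].
have : 0 <= qform ((C%:C * ntrace T)%:M - S T) v := hu v.
rewrite qformD qformN qform_scalar complex_ge0 => /andP[_].
rewrite sqnorm_nsq ReD ReN !ReM /= !mul0r !subr0 mulr0 subr0.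
by rewrite subr_ge0.
Qed.

(** Test flatness on the rank one matrix [z z^*]: the quadratic form of its image
    at [y] is the sum of the [|y^* w_k z|^2] and is at least
    [c |z|^2 |y|^2 / N]. *)
Lemma flat_irreducible : irreducible_kraus w.
Proof.
move=> y z yz0.
pose T := z *m z^t*.
have pT : psdmx T.
  split; first by apply/hermP; rewrite /T adjM trmxCK.
  move=> v; have -> : (v^t* *m T *m v) 0 0 = sqnorm (z^t* *m v).
    by rewrite -qform_gram trmxCK.
  exact: sqnorm_ge0.
have trT : \tr T = sqnorm z.
  by rewrite /T mxtrace_mulC /mxtrace big_ord1.
have := flat_lower y pT.
have -> : qform (S T) y = 0.
  rewrite /S /kraus qform_sum big1 // => k _.
  rewrite /T /qform !mulmxA yz0 !mul0mx mxE //.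
rewrite ntrace_Re trT -/(nsq z) /= => h.
have N0 : 0 < (N%:R : R)^-1 by rewrite invr_gt0 ltr0n.
have eq0 m (v : 'cV[R[i]]_m) : nsq v = 0 -> v = 0.
  by move=> v0; apply: sqnorm_eq0; rewrite sqnorm_nsq v0.
have [z0|z0] := eqVneq (nsq z) 0; first by right; exact: eq0.
left; apply: eq0; apply/eqP; rewrite eq_le nsq_ge0 andbT.
have z1 : 0 < nsq z by rewrite lt_neqAle eq_sym z0 nsq_ge0.
by move: h; rewrite pmulr_rle0 // !mulr_gt0.
Qed.

Definition dyson_op z X : 'M[R[i]]_N := z%:M - A + S X.

Section Solution.
Variables (z : R[i]) (M : 'M[R[i]]_N).
Hypothesis hM : 1%:M + dyson_op z M *m M = 0.
Let Y := dyson_op z M.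

Lemma dyson_mulr : Y *m M = - 1%:M.
Proof. by apply/eqP; rewrite -addr_eq0 addrC; apply/eqP. Qed.

Lemma dyson_mull : M *m Y = - 1%:M.
Proof.
have : (- Y) *m M = 1%:M by rewrite mulNmx dyson_mulr opprK.
by move=> /mulmx1C; rewrite mulmxN => <-; rewrite opprK.
Qed.

Lemma immx_dyson_op : immx Y = (Im z)%:C%:M + S (immx M).
Proof.
rewrite /immx /Y /dyson_op /S !adjD adjN adj_scalar hA kraus_adj krausZ krausB.
rewrite !opprD opprK.
have -> : z%:M - A + kraus w M + (- (Num.conj z)%:M + A - kraus w (M^t*))
   = (z - Num.conj z)%:M + (kraus w M - kraus w (M^t*)) :> 'M[R[i]]_N.
  by rewrite raddfB /=; apply/matrixP => i j; rewrite !mxE; ring.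
rewrite scalerDr scale_scalar_mx; congr (_%:M + _).
by case: z => a b; apply: complexP => /=; field.
Qed.

Lemma immx_adj_opp X : immx (- X^t*) = immx X.
Proof. by rewrite /immx adjN trmxCK opprK addrC. Qed.

(** Multiply the Dyson equation by [M^*] on the left and take imaginary parts.
    The other order of the factors gives [dyson_immxr]. *)
Lemma dyson_immx : immx M = M^t* *m ((Im z)%:C%:M + S (immx M)) *m M.
Proof.
rewrite -immx_dyson_op -immx_conj -mulmxA dyson_mulr mulmxN mulmx1.
by rewrite immx_adj_opp.
Qed.

Lemma dyson_immxr : immx M = M *m ((Im z)%:C%:M + S (immx M)) *m M^t*.
Proof.
rewrite -immx_dyson_op -{2}[M]trmxCK -immx_conj trmxCK dyson_mull mulNmx mul1mx.
by rewrite immx_adj_opp.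
Qed.

Lemma qform_dyson_op v : qform Y (M *m v) = - Num.conj (qform M v).
Proof.
by rewrite -qform_congr -mulmxA dyson_mulr mulmxN mulmx1 qformN qform_adj.
Qed.

Lemma Im_qform_dyson v :
  Im (qform M v) = Im z * nsq (M *m v) + Re (qform (S (immx M)) (M *m v)).
Proof.
have -> : Im (qform M v) = Re (qform (immx M) v) by rewrite qform_immx.
rewrite {1}dyson_immx qform_congr qformD qform_scalar sqnorm_nsq ReD.
by rewrite ReM /= mul0r subr0.
Qed.

(** The squared Hilbert-Schmidt norm, by columns: this is how it arises when the
    trace of [M^* X M] is computed on the standard basis. *)
Definition hsnorm2 X : R := \sum_j nsq (X *m delta_mx j 0).

Lemma hsnorm2E X : hsnorm2 X = \sum_j \sum_i (Re (X i j) ^+ 2 + Im (X i j) ^+ 2).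
Proof.
apply: eq_bigr => j _; rewrite nsqE; apply: eq_bigr => i _.
by rewrite -colE mxE.
Qed.

Lemma hsnorm2_entry X i j : Re (X i j) ^+ 2 + Im (X i j) ^+ 2 <= hsnorm2 X.
Proof.
rewrite hsnorm2E (bigD1 j) //= (bigD1 i) //= -addrA lerDl.
by rewrite addr_ge0 // sumr_ge0 // => k _; rewrite ?sumr_ge0 // => *;
   rewrite addr_ge0 // sqr_ge0.
Qed.

Lemma Re_tr_immx : Re (\tr (immx M)) =
  \sum_j (Im z * nsq (M *m delta_mx j 0)
          + Re (qform (S (immx M)) (M *m delta_mx j 0))).
Proof.
rewrite trace_immx /= mxtrace_qform Im_sum; apply: eq_bigr => j _.
exact: Im_qform_dyson.
Qed.

(** Taking the trace of [Im M = M^* (Im z + S[Im M]) M] and bounding [S[Im M]]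
    from below by flatness leaves a factor [tr (Im M)] on both sides. *)
Lemma dyson_hsnorm2_le : 0 <= Im z -> psdmx (immx M) ->
  0 < Re (\tr (immx M)) -> c * hsnorm2 M <= N%:R.
Proof.
move=> z0 pV tV.
have : Re (\tr (immx M)) >= \sum_j (c * Re (ntrace (immx M)) * nsq (M *m delta_mx j 0)).
  rewrite Re_tr_immx; apply: ler_sum => j _.
  apply: le_trans (flat_lower _ pV) _.
  by rewrite lerDr mulr_ge0 // nsq_ge0.
rewrite -mulr_sumr -/(hsnorm2 M) ntrace_Re.
set t := Re _; set h := hsnorm2 M => le1.
have Np : 0 < (N%:R : R) by rewrite ltr0n.
have : (c * h) * t <= N%:R * t.
  have := ler_wpM2l (ltW Np) le1.
  have -> : N%:R * (c * (N%:R^-1 * t) * h) = c * h * t by field; rewrite gt_eqF.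
  by [].
by rewrite ler_pM2r.
Qed.

End Solution.

(** From [|a| <= 1 + |a|^2] on every entry. *)
Lemma l1norm_le_hs X : Re (l1norm X) <= N%:R ^+ 2 + hsnorm2 X.
Proof.
rewrite /l1norm hsnorm2E exchange_big Re_sum expr2.
have -> : (N%:R * N%:R : R) = \sum_(j < N) \sum_(i < N) 1.
  by rewrite !sumr_const card_ord -[RHS]mulr_natr.
rewrite -big_split; apply: ler_sum => j _; rewrite Re_sum -big_split.
apply: ler_sum => i _; rewrite normc_def /=.
set x := _ + _.
have x0 : 0 <= x by rewrite addr_ge0 // sqr_ge0.
by have := sqr_sqrtr x0; have := sqrtr_ge0 x; nra.
Qed.

Lemma norm_Re_qform X v : `|Re (qform X v)| <= Re (l1norm X) * nsq v.
Proof.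
have := le_trans (normc_ge_Re _) (norm_qform_le X v).
by rewrite sqnorm_nsq lecE => /andP[_]; rewrite ReM /= mulr0 subr0.
Qed.

Lemma nsq_combo (k : R) X v :
  nsq (v - k%:C *: (X *m v))
  = nsq v - 2 * k * Re (qform X v) + k ^+ 2 * nsq (X *m v).
Proof.
have n2 : `|k%:C| ^+ 2 = (k ^+ 2)%:C :> R[i].
  by rewrite normc_def /= expr0n addr0 sqrtr_sqr -rmorphXn real_normK // num_real.
have := congr1 (@complex.Re R) (sqnorm_sub X k%:C v).
rewrite n2 !sqnorm_nsq !(ReD, ReN) ReJ !ReM /= => ->; ring.
Qed.

(** For [Re z] very negative, [- (z - A + S[M])], the inverse of [M], has real
    part at least [k = 1 + 2 C], because [S[M]] is bounded a priori.  Hence [M]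
    has positive real part and [tr (M^* M) <= N / k^2]; this makes the factor in
    [Im M = M^* (Im z + S[Im M]) M] small enough to absorb the self-energy, so
    that [Im M] is of order [Im z]. *)
Lemma dyson_left_end : exists a0 : R, forall z M, Re z <= a0 -> 0 < Im z ->
  mde_solution A S z M ->
  Re (ntrace (immx M)) <= Im z /\
  forall v, Im (qform M v) <= (1 + C) * Im z * Re (qform M v).
Proof.
pose L := Re (\sum_k l1norm (w k) ^+ 2).
pose bS := L * (N%:R ^+ 2 + N%:R / c).
pose k := 1 + 2 * C.
exists (- (Re (l1norm A) + bS + k)) => z M za z0 [hM [hV pV]].
have Np : 0 < (N%:R : R) by rewrite ltr0n.
have pV' := posdefmx_psdmx (conj hV pV).
have trV := posdefmx_trace (conj hV pV).
have hs : hsnorm2 M <= N%:R / c.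
  by rewrite ler_pdivlMr // mulrC (dyson_hsnorm2_le hM) // ltW.
have L0 : 0 <= L.
  suff : 0 <= \sum_k l1norm (w k) ^+ 2 by rewrite complex_ge0 => /andP[].
  by apply: sumr_ge0 => i _; rewrite exprn_ge0 // l1norm_ge0.
have SM : Re (l1norm (S M)) <= bS.
  have := l1norm_kraus w M; rewrite lecE => /andP[_].
  have /eqP M0 : Im (l1norm M) == 0.
    by have := l1norm_ge0 M; rewrite complex_ge0 => /andP[].
  rewrite ReM M0 mulr0 subr0 => /le_trans; apply; rewrite ler_wpM2l //.
  by apply: le_trans (l1norm_le_hs _) _; rewrite lerD2l.
have Rq v : k * nsq (M *m v) <= Re (qform M v).
  have -> : Re (qform M v) = - Re (qform (dyson_op z M) (M *m v)).
    by rewrite qform_dyson_op // ReN ReJ opprK.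
  set y := M *m v; rewrite /dyson_op !qformD qformN qform_scalar sqnorm_nsq.
  rewrite !ReD ReN ReM /= mulr0 subr0.
  have := norm_Re_qform A y; have := norm_Re_qform (S M) y.
  rewrite !ler_norml => /andP[_ s2] /andP[a1 _].
  have y0 := nsq_ge0 y.
  have := ler_wpM2r y0 za; have := ler_wpM2r y0 SM.
  lra.
have k0 : 1 <= k by rewrite /k; move: (hC); lra.
(* Expand |v - k M v|^2 >= 0 and use k |M v|^2 <= Re (v^* M v). *)
have yv v : k ^+ 2 * nsq (M *m v) <= nsq v.
  have := nsq_ge0 (v - k%:C *: (M *m v)); rewrite nsq_combo.
  by have := Rq v; have := nsq_ge0 (M *m v); nra.
have HSk : k ^+ 2 * hsnorm2 M <= N%:R.
  rewrite mulr_sumr; apply: (@le_trans _ _ (\sum_(i < N) 1)); last first.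
    by rewrite sumr_const card_ord.
  by apply: ler_sum => i _; rewrite -(nsq_delta i) yv.
have ImU v : Im (qform M v) <= (Im z + C * Re (ntrace (immx M))) * nsq (M *m v).
  rewrite (Im_qform_dyson hM) mulrDl lerD2l; exact: flat_upper.
have V1 : Re (ntrace (immx M)) <= Im z.
  have : N%:R * Re (ntrace (immx M)) <= (Im z + C * Re (ntrace (immx M))) * hsnorm2 M.
    rewrite {1}ntrace_Re mulrA divff ?gt_eqF // mul1r trace_immx mxtrace_qform /=.
    by rewrite Im_sum mulr_sumr ler_sum.
  have : 0 < Re (ntrace (immx M)) by rewrite ntrace_Re mulr_gt0 ?invr_gt0.
  move: HSk; set t := Re _; set h := hsnorm2 M => HSk t0 le1.
  have e0 : 0 < Im z + C * t by rewrite addr_gt0 // mulr_gt0.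
  have : k ^+ 2 * (N%:R * t) <= (Im z + C * t) * N%:R.
    have k2 : 0 <= k ^+ 2 by rewrite sqr_ge0.
    apply: le_trans (ler_wpM2l k2 le1) _.
    by rewrite mulrCA ler_wpM2l // ltW.
  rewrite mulrCA (mulrC _ N%:R) ler_pM2l // => le2.
  have kt : k * t <= k ^+ 2 * t.
    by rewrite ler_pM2r // expr2 ler_peMl // (le_trans ler01).
  have := le_trans kt le2; have := mulr_gt0 hC t0; rewrite /k => Ct le3; lra.
split => // v.
have := ImU v; have := Rq v; have := nsq_ge0 (M *m v).
move: V1; set t := Re _; set q := Re (qform M v); set n := nsq _ => V1 n0 q1 i1.
apply: le_trans i1 _.
apply: (@le_trans _ _ ((1 + C) * Im z * n)).
  rewrite ler_wpM2r // mulrDl mul1r lerD2l ler_wpM2l //; exact: ltW.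
rewrite ler_wpM2l //.
  by rewrite mulr_ge0 ?addr_ge0 ?ltW.
by apply: le_trans q1; rewrite ler_peMl.
Qed.

(** The resolvent identity turns the difference of two solutions into a fixed
    point of [X |-> M1 S[X] M2]; at a real point the imaginary parts are exact
    fixed points of the diagonal maps, as [kraus_intertwiner] requires. *)
Lemma dyson_real_unique (x : R) M1 M2 :
  1%:M + dyson_op x%:C M1 *m M1 = 0 -> 1%:M + dyson_op x%:C M2 *m M2 = 0 ->
  posdefmx (immx M1) -> posdefmx (immx M2) -> M1 = M2.
Proof.
move=> h1 h2 [hV1 pV1] [hV2 pV2].
have Sx M (h : 1%:M + dyson_op x%:C M *m M = 0) :
    immx M = M^t* *m S (immx M) *m M /\ immx M = M *m S (immx M) *m M^t*.
  have z0 : (Im (x%:C : R[i]))%:C%:M = 0 :> 'M[R[i]]_N by rewrite /= raddf0.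
  by split; [rewrite {1}(dyson_immx h)|rewrite {1}(dyson_immxr h)]; rewrite z0 add0r.
have e : M1 - M2 = M1 *m S (M1 - M2) *m M2.
  have -> : S (M1 - M2) = dyson_op x%:C M1 - dyson_op x%:C M2.
    by rewrite /S krausB /dyson_op opprD addrACA subrr add0r.
  rewrite mulmxBr mulmxBl (dyson_mull h1) -mulmxA (dyson_mulr h2).
  by rewrite mulNmx mulmxN mul1mx mulmx1 opprK addrC.
have [/eqP|M21] := @kraus_intertwiner _ _ _ w flat_irreducible M1 M2 (immx M1) (immx M2) (M1 - M2)
  (immx_adj _) (immx_adj _) pV1 pV2 (Sx _ h1).2 (Sx _ h2).1 e.
  by rewrite subr_eq0 => /eqP.
have v0 : delta_mx (Ordinal hN) 0 != 0 :> 'cV[R[i]]_N by exact: delta_neq0.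
have p1 : 0 < qform (immx M1) (delta_mx (Ordinal hN) 0) := pV1 _ v0.
have p2 : 0 < qform (immx M2) (delta_mx (Ordinal hN) 0) := pV2 _ v0.
move: p1 p2; rewrite !qform_immx M21 qform_adj !ltcR ImJ oppr_gt0.
by move=> /lt_trans h /h; rewrite ltxx.
Qed.

End Dyson.

(** * Derivatives, limits and arguments of complex functions *)

Section ComplexDerivative.
Context {R : realType}.
Implicit Types (f g : R -> R[i]) (x : R) (l : R[i]).

(** Componentwise, because [R[i]] is a normed space over itself and not over
    [R]. *)
Definition cderiv f x l :=
  is_derive x 1 (fun t => Re (f t)) (Re l) /\
  is_derive x 1 (fun t => Im (f t)) (Im l).

Lemma cderiv_cst a x : cderiv (fun=> a) x 0.
Proof. by split; exact: is_derive_cst. Qed.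

Lemma cderivD f g x l m : cderiv f x l -> cderiv g x m ->
  cderiv (fun t => f t + g t) x (l + m).
Proof.
move=> [f1 f2] [g1 g2]; split.
  under eq_fun do rewrite ReD; rewrite ReD; exact: is_deriveD.
under eq_fun do rewrite ImD; rewrite ImD; exact: is_deriveD.
Qed.

Lemma cderivM f g x l m : cderiv f x l -> cderiv g x m ->
  cderiv (fun t => f t * g t) x (l * g x + f x * m).
Proof.
move=> [f1 f2] [g1 g2]; split.
  under eq_fun do rewrite ReM.
  apply: is_derive_eq (is_deriveB (is_deriveM f1 g1) (is_deriveM f2 g2)) _.
  by rewrite ReD !ReM /GRing.scale /=; ring.
under eq_fun do rewrite ImM.
apply: is_derive_eq (is_deriveD (is_deriveM f1 g2) (is_deriveM f2 g1)) _.
by rewrite ImD !ImM /GRing.scale /=; ring.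
Qed.

Lemma cderivN f x l : cderiv f x l -> cderiv (fun t => - f t) x (- l).
Proof.
move=> [f1 f2]; split.
  under eq_fun do rewrite ReN; rewrite ReN; exact: is_deriveN.
under eq_fun do rewrite ImN; rewrite ImN; exact: is_deriveN.
Qed.

Lemma cderiv_sum (I : Type) (r : seq I) (F : I -> R -> R[i]) x (l : I -> R[i]) :
  (forall i, cderiv (F i) x (l i)) ->
  cderiv (fun t => \sum_(i <- r) F i t) x (\sum_(i <- r) l i).
Proof.
move=> h; elim: r => [|i r IH].
  by rewrite big_nil; under eq_fun do rewrite big_nil; exact: cderiv_cst.
by rewrite big_cons; under eq_fun do rewrite big_cons; exact: cderivD.
Qed.

Lemma normc2_neq0 (z : R[i]) : z != 0 -> Re z ^+ 2 + Im z ^+ 2 != 0.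
Proof.
case: z => a b; apply: contra => /=; rewrite paddr_eq0 ?sqr_ge0 //.
by rewrite !sqrf_eq0 => /andP[/eqP -> /eqP ->].
Qed.

Lemma ReV (z : R[i]) : Re z^-1 = Re z / (Re z ^+ 2 + Im z ^+ 2).
Proof. by case: z. Qed.

Lemma ImV (z : R[i]) : Im z^-1 = - (Im z / (Re z ^+ 2 + Im z ^+ 2)).
Proof. by case: z. Qed.

Lemma cderivV f x l : f x != 0 -> cderiv f x l ->
  cderiv (fun t => (f t)^-1) x (- (l / f x ^+ 2)).
Proof.
move=> fx0 [f1 f2]; have n0 := normc2_neq0 fx0.
pose n t := Re (f t) ^+ 2 + Im (f t) ^+ 2.
have dn : is_derive x 1 n (2 * (Re (f x) * Re l + Im (f x) * Im l)).
  have -> : n = (fun t => Re (f t) * Re (f t) + Im (f t) * Im (f t)).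
    by apply/funext => t; rewrite /n !expr2.
  apply: is_derive_eq (is_deriveD (is_deriveM f1 f1) (is_deriveM f2 f2)) _.
  by rewrite /GRing.scale /=; ring.
have dV := @is_deriveV _ n x _ _ n0 dn.
split.
  under eq_fun do rewrite ReV.
  apply: is_derive_eq (is_deriveM f1 dV) _.
  rewrite /n /GRing.scale /= ReN ReM !(ReV, ImV) expr2 !(ReM, ImM).
  move: n0; set a := Re (f x); set b := Im (f x) => n0.
  have -> : (a * a - b * b) ^+ 2 + (a * b + b * a) ^+ 2 = (a ^+ 2 + b ^+ 2) ^+ 2 by ring.
  by field.
under eq_fun do rewrite ImV.
apply: is_derive_eq (is_deriveN (is_deriveM f2 dV)) _.
rewrite /n /GRing.scale /= ImN ImM !(ReV, ImV) expr2 !(ReM, ImM).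
move: n0; set a := Re (f x); set b := Im (f x) => n0.
have -> : (a * a - b * b) ^+ 2 + (a * b + b * a) ^+ 2 = (a ^+ 2 + b ^+ 2) ^+ 2 by ring.
by field.
Qed.

(** The argument in (0, pi) of a point of the upper half-plane. *)
Definition carg (z : R[i]) : R := pi / 2 - atan (Re z / Im z).

(** The derivative of [Im (log f)]. *)
Lemma carg_deriv f x l : 0 < Im (f x) -> cderiv f x l ->
  is_derive x 1 (fun t => carg (f t)) (Im (l / f x)).
Proof.
move=> fx0 [f1 f2].
have n0 : Im (f x) != 0 by rewrite gt_eqF.
have dV := is_deriveM f1 (@is_deriveV _ (fun t => Im (f t)) x _ _ n0 f2).
have := is_deriveB (is_derive_cst (pi / 2) x 1) (is_derive1_comp (is_derive1_atan _) dV).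
move=> h; apply: is_derive_eq h _.
rewrite ImM ReV ImV /GRing.scale /=.
rewrite -[X in 1 + X ^+ 2]/(Re (f x) * (Im (f x))^-1).
move: n0; set a := Re (f x); set b := Im (f x) => n0.
have ab : a ^+ 2 + b ^+ 2 != 0.
  by rewrite gt_eqF // ltr_wpDl ?sqr_ge0 // exprn_even_gt0.
by field; rewrite ab n0.
Qed.
End ComplexDerivative.

Section CargLimits.
Context {R : realType} {T : Type} {F : set_system T} {FF : Filter F}.
Implicit Types (z : T -> R[i]).

(** The points stay in a sector around the positive axis whose opening shrinks
    to 0. *)
Lemma carg_cvg0 z (e : T -> R) :
  (\forall t \near F, [/\ 0 < e t, 0 < Im (z t) & Im (z t) <= e t * Re (z t)]) ->
  e t @[t --> F] --> 0 -> carg (z t) @[t --> F] --> 0.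
Proof.
move=> hz e0.
suff h : (Re (z t) / Im (z t)) @[t --> F] --> +oo.
  have h2 := cvg_comp _ _ h (@cvgy_atan R).
  by rewrite -(subrr (pi / 2)); apply: cvgB; [exact: cvg_cst|exact: h2].
apply/cvgryPge => B.
have B'0 : 0 < (`|B| + 1)^-1 by rewrite invr_gt0 ltr_wpDl.
near=> t.
have [et0 i0 ie] : [/\ 0 < e t, 0 < Im (z t) & Im (z t) <= e t * Re (z t)] by near: t.
have et : `|e t| < (`|B| + 1)^-1.
  by near: t; have /cvgr0Pnorm_lt := e0; apply.
rewrite ler_pdivlMr //.
apply: (@le_trans _ _ ((`|B| + 1) * Im (z t))).
  by rewrite ler_pM2r // (le_trans (ler_norm _)) // lerDl.
have rz0 : 0 < Re (z t) by have := lt_le_trans i0 ie; rewrite pmulr_rgt0.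
have B1 : 0 < `|B| + 1 by rewrite ltr_wpDl.
rewrite -(ler_pM2l B1) in ie; apply: le_trans ie _.
rewrite mulrA -[leRHS]mul1r ler_pM2r // -ler_pdivlMl // mulr1.
exact/ltW/(le_lt_trans (ler_norm _)).
Unshelve. all: by end_near. Qed.

Lemma carg_opp_conj (a : R[i]) : carg (- Num.conj a) = pi - carg a.
Proof. by rewrite /carg ReN ImN ReJ ImJ opprK mulNr atanN; field. Qed.

Lemma carg_cvg z (l : R) : l != 0 ->
  (\forall t \near F, 0 < Im (z t)) ->
  Re (z t) @[t --> F] --> l -> Im (z t) @[t --> F] --> 0 ->
  carg (z t) @[t --> F] --> (if l < 0 then pi else 0).
Proof.
have pos (y : T -> R[i]) (k : R) : 0 < k -> (\forall t \near F, 0 < Im (y t)) ->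
    Re (y t) @[t --> F] --> k -> Im (y t) @[t --> F] --> 0 ->
    carg (y t) @[t --> F] --> 0.
  move=> k0 hy hr hi; apply: (@carg_cvg0 _ (fun t => Im (y t) / Re (y t))).
    near=> t; have i0 : 0 < Im (y t) by near: t.
    have r0 : 0 < Re (y t) by near: t; exact: (cvgr_gt _ hr).
    by split; rewrite ?divr_gt0 // divfK ?gt_eqF.
  rewrite -(mul0r k^-1); apply: cvgM => //; apply: cvgV => //.
  by rewrite gt_eqF.
move=> l0 hz hr hi; case: ltrP => ll; last first.
  by apply: (pos _ l) => //; rewrite lt_neqAle eq_sym l0.
have -> : (fun t => carg (z t)) = (fun t => pi - carg (- Num.conj (z t))).
  by apply/funext => t; rewrite carg_opp_conj subKr.
rewrite -[X in _ --> X]subr0; apply: cvgB; first exact: cvg_cst.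
apply: (pos _ (- l)); first by rewrite oppr_gt0.
- by near=> t; rewrite ImN ImJ opprK; near: t.
- by under eq_fun do rewrite ReN ReJ; exact: cvgN.
- by under eq_fun do rewrite ImN ImJ opprK.
Unshelve. all: by end_near. Qed.

End CargLimits.

Section ComplexLimits.
Context {R : realType} {T : Type} {F : set_system T} {FF : Filter F}.
Implicit Types (z y : T -> R[i]) (l m : R[i]).

Definition ccvg z l :=
  Re (z t) @[t --> F] --> Re l /\ Im (z t) @[t --> F] --> Im l.

Lemma ccvg_cst l : ccvg (fun=> l) l.
Proof. by split; exact: cvg_cst. Qed.

Lemma ccvgD z y l m : ccvg z l -> ccvg y m -> ccvg (fun t => z t + y t) (l + m).
Proof.
move=> [z1 z2] [y1 y2]; split.
  by rewrite ReD; under eq_fun do rewrite ReD; exact: cvgD.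
by rewrite ImD; under eq_fun do rewrite ImD; exact: cvgD.
Qed.

Lemma ccvgN z l : ccvg z l -> ccvg (fun t => - z t) (- l).
Proof.
move=> [z1 z2]; split.
  by rewrite ReN; under eq_fun do rewrite ReN; exact: cvgN.
by rewrite ImN; under eq_fun do rewrite ImN; exact: cvgN.
Qed.

Lemma ccvgM z y l m : ccvg z l -> ccvg y m -> ccvg (fun t => z t * y t) (l * m).
Proof.
move=> [z1 z2] [y1 y2]; split.
  by rewrite ReM; under eq_fun do rewrite ReM; apply: cvgB; exact: cvgM.
by rewrite ImM; under eq_fun do rewrite ImM; apply: cvgD; exact: cvgM.
Qed.

Lemma ccvgV z l : l != 0 -> ccvg z l -> ccvg (fun t => (z t)^-1) l^-1.
Proof.
move=> /normc2_neq0 l0 [z1 z2].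
have n0 : Re (z t) ^+ 2 + Im (z t) ^+ 2 @[t --> F] --> Re l ^+ 2 + Im l ^+ 2.
  by rewrite !expr2; under eq_fun do rewrite !expr2; apply: cvgD; exact: cvgM.
split.
  rewrite ReV; under eq_fun do rewrite ReV.
  by apply: cvgM => //; exact: cvgV.
rewrite ImV; under eq_fun do rewrite ImV.
by apply: cvgN; apply: cvgM => //; exact: cvgV.
Qed.

Lemma ccvg_sum (I : Type) (r : seq I) (z : I -> T -> R[i]) (l : I -> R[i]) :
  (forall i, ccvg (z i) (l i)) ->
  ccvg (fun t => \sum_(i <- r) z i t) (\sum_(i <- r) l i).
Proof.
move=> h; elim: r => [|i r IH].
  by rewrite big_nil; under eq_fun do rewrite big_nil; exact: ccvg_cst.
by rewrite big_cons; under eq_fun do rewrite big_cons; exact: ccvgD.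
Qed.

Lemma ccvgJ z l : ccvg z l -> ccvg (fun t => Num.conj (z t)) (Num.conj l).
Proof.
move=> [z1 z2]; split.
  by rewrite ReJ; under eq_fun do rewrite ReJ.
by rewrite ImJ; under eq_fun do rewrite ImJ; exact: cvgN.
Qed.

End ComplexLimits.
Arguments ccvg {R T} F z l.

(** * The sum of the arguments of the pivots *)

Section SchurComplement.
Context {F : fieldType}.

(** The matrix left after one step of Gaussian elimination on the first row and
    column. *)
Definition schur n (M : 'M[F]_n.+1) : 'M[F]_n :=
  \matrix_(i, j) (M (lift ord0 i) (lift ord0 j)
                  - M (lift ord0 i) 0 * M 0 (lift ord0 j) / M 0 0).

(** The first pivot splits off from the logarithmic derivative [tr (M^-1 M')] of
    the determinant: the matrix on the right is the derivative of the Schur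
    complement, whose inverse is the lower right block of [M^-1]. *)
Lemma trace_schur n (M M' Z : 'M[F]_(1 + n)) : M 0 0 != 0 ->
  M *m Z = 1%:M ->
  schur M *m drsubmx Z = 1%:M /\
  \tr (Z *m M') = M' 0 0 / M 0 0 + \tr (drsubmx Z *m \matrix_(i, j)
    (M' (lift ord0 i) (lift ord0 j)
     - ((M' (lift ord0 i) 0 * M 0 (lift ord0 j)
         + M (lift ord0 i) 0 * M' 0 (lift ord0 j)) / M 0 0
     - M (lift ord0 i) 0 * M 0 (lift ord0 j) * M' 0 0 / M 0 0 ^+ 2))).
Proof.
move=> M0 MZ; have ZM : Z *m M = 1%:M by apply: mulmx1C.
set D := \matrix_(i, j) _.
pose s := M 0 0; pose s' := M' 0 0.
have l0 : lshift n (0 : 'I_1) = 0 by apply: val_inj.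
have ul (X : 'M[F]_(1 + n)) : ulsubmx X = (X 0 0)%:M.
  by apply/matrixP => i j; rewrite !ord1 !mxE l0 eqxx mulr1n.
have ScE : schur M = drsubmx M - s^-1 *: (dlsubmx M *m ursubmx M).
  apply/matrixP => i j; rewrite !mxE big_ord1 !mxE l0 !rshift1.
  by rewrite [s^-1 * _]mulrC.
have DE : D = drsubmx M' - s^-1 *: (dlsubmx M' *m ursubmx M + dlsubmx M *m ursubmx M')
     + (s' / s ^+ 2) *: (dlsubmx M *m ursubmx M).
  apply/matrixP => i j; rewrite !mxE !big_ord1 !mxE l0 !rshift1 /s /s'.
  ring.
set z := Z 0 0; set z12 := ursubmx Z; set z21 := dlsubmx Z; set Z2 := drsubmx Z.
have [e11 e12 e22] : [/\ s%:M *m z%:M + ursubmx M *m z21 = 1%:M,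
    s *: z12 + ursubmx M *m Z2 = 0 & dlsubmx M *m z12 + drsubmx M *m Z2 = 1%:M].
  move: MZ; rewrite -{1}[M]submxK -{1}[Z]submxK mulmx_block !ul (scalar_mx_block 1 n 1).
  by rewrite !mul_scalar_mx => /eq_block_mx[e11 e12 _ e22].
have f21 : s *: z21 + Z2 *m dlsubmx M = 0.
  move: ZM; rewrite -{1}[Z]submxK -{1}[M]submxK mulmx_block !ul (scalar_mx_block 1 n 1).
  by rewrite !mul_mx_scalar => /eq_block_mx[_ _ f21 _].
have sn : s != 0 by [].
have z12E : z12 = - (s^-1 *: (ursubmx M *m Z2)).
  apply: (scalerI sn); rewrite scalerN scalerA divff // scale1r.
  by apply/eqP; rewrite -addr_eq0 e12.
have z21E : z21 = - (s^-1 *: (Z2 *m dlsubmx M)).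
  apply: (scalerI sn); rewrite scalerN scalerA divff // scale1r.
  by apply/eqP; rewrite -addr_eq0 f21.
split.
  rewrite ScE mulmxBl -scalemxAl -mulmxA -e22 addrC; congr (_ + _).
  by rewrite z12E mulmxN -scalemxAr.
have -> : \tr (Z *m M') = z * s' + \tr (z12 *m dlsubmx M')
    + \tr (z21 *m ursubmx M') + \tr (Z2 *m drsubmx M').
  rewrite -{1}[Z]submxK -{1}[M']submxK mulmx_block mxtrace_block.
  rewrite !ul mul_scalar_mx !raddfD /= scale_scalar_mx mxtrace_scalar mulr1n.
  by rewrite !addrA.
have e11' : \tr (ursubmx M *m Z2 *m dlsubmx M) = s * (s * z - 1).
  have := congr1 mxtrace e11; rewrite raddfD /= -scalar_mxM !mxtrace_scalar !mulr1n.
  rewrite z21E mulmxN raddfN /= -scalemxAr mxtraceZ mulmxA.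
  by move=> <-; field.
rewrite DE !mulmxDr mulmxN -!scalemxAr !raddfD /= raddfN /= !mxtraceZ raddfN /= mxtraceZ.
rewrite z12E z21E !mulNmx !raddfN /= -!scalemxAl !mxtraceZ.
rewrite [\tr (Z2 *m (dlsubmx M' *m _))]mxtrace_mulC.
rewrite [\tr (Z2 *m (dlsubmx M *m ursubmx M))]mxtrace_mulC.
rewrite -[dlsubmx M' *m ursubmx M *m Z2]mulmxA [\tr (dlsubmx M' *m _)]mxtrace_mulC.
rewrite -[dlsubmx M *m ursubmx M *m Z2]mulmxA [\tr (dlsubmx M *m (ursubmx M *m Z2))]mxtrace_mulC.
rewrite e11' !mulmxA -/s -/s'; field.
exact: sn.
Qed.

End SchurComplement.

Section ArgSum.
Context {R : realType}.

(** A continuous determination of [arg det M] on the matrices whose numerical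
    range lies in the upper half-plane. *)
Fixpoint argsum n : 'M[R[i]]_n -> R :=
  match n with
  | 0 => fun=> 0
  | n'.+1 => fun M => carg (M 0 0) + argsum (schur M)
  end.

(** Complete [v] to the vector [x] for which the first entry of [M x] vanishes;
    the other entries are then those of [schur M *m v]. *)
Lemma qform_schur n (M : 'M[R[i]]_n.+1) (v : 'cV[R[i]]_n) : M 0 0 != 0 ->
  exists2 x : 'cV[R[i]]_n.+1, (forall i, x (lift ord0 i) 0 = v i 0)
    & qform M x = qform (schur M) v.
Proof.
move=> M0; pose x0 := - (\sum_j M 0 (lift ord0 j) * v j 0) / M 0 0.
have [x xl x00] : exists2 x : 'cV[R[i]]_n.+1,
    (forall i, x (lift ord0 i) 0 = v i 0) & x 0 0 = x0.
  exists (\col_i (if unlift ord0 i is Some j then v j 0 else x0)).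
    by move=> i; rewrite mxE liftK.
  by rewrite mxE unlift_none.
exists x => //.
have Mx0 : (M *m x) 0 0 = 0.
  rewrite mxE big_ord_recl x00; under eq_bigr => i _ do rewrite xl.
  by rewrite /x0 mulrC divfK // addNr.
have Mxl i : (M *m x) (lift ord0 i) 0 = (schur M *m v) i 0.
  rewrite [LHS]mxE [RHS]mxE big_ord_recl x00.
  under eq_bigr => j _ do rewrite xl.
  under [RHS]eq_bigr => j _ do rewrite mxE mulrBl.
  rewrite /x0.
  rewrite sumrB addrC; congr (_ + _).
  rewrite mulNr mulrN mulr_suml mulr_sumr; congr (- _); apply: eq_bigr => j _.
  ring.
rewrite /qform -!mulmxA [LHS]mxE [RHS]mxE big_ord_recl Mx0 mulr0 add0r.
apply: eq_bigr => i _; rewrite Mxl.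
have xTl : x^T 0 (lift ord0 i) = v^T 0 i by rewrite [LHS]mxE [RHS]mxE xl.
by rewrite [x^t* _ _]mxE xTl [v^t* _ _]mxE.
Qed.

(** The vectors are not normalized, so this constrains the numerical range only
    when [p] is invariant under positive scaling, as a cone is. *)
Definition numrange n (M : 'M[R[i]]_n) (p : R[i] -> Prop) :=
  forall x : 'cV[R[i]]_n, x != 0 -> p (qform M x).

Lemma numrange_diag n (M : 'M[R[i]]_n) p i : numrange M p -> p (M i i).
Proof.
by move=> h; rewrite -qform_delta; apply: h; exact: delta_neq0.
Qed.

Lemma numrange_schur n (M : 'M[R[i]]_n.+1) p : M 0 0 != 0 ->
  numrange M p -> numrange (schur M) p.
Proof.
move=> M0 h v v0; have [x xv <-] := qform_schur v M0; apply: h.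
apply: contra v0 => /eqP x0; apply/eqP/colP => i.
by rewrite -xv x0 !mxE.
Qed.

Definition upper_half (a : R[i]) := 0 < Im a.

Lemma upper_half_neq0 (a : R[i]) : upper_half a -> a != 0.
Proof. by rewrite /upper_half; apply: contraTneq => ->; rewrite ltxx. Qed.

Lemma argsum_deriv n (M : R -> 'M[R[i]]_n) (x : R) (M' Z : 'M[R[i]]_n) :
  numrange (M x) upper_half -> (forall i j, cderiv (fun t => M t i j) x (M' i j)) ->
  M x *m Z = 1%:M ->
  is_derive x 1 (fun t => argsum (M t)) (Im (\tr (Z *m M'))).
Proof.
elim: n M M' Z => [|n IH] M M' Z hM dM MZ.
  have -> : \tr (Z *m M') = 0 by rewrite /mxtrace big_ord0.
  exact: is_derive_cst.
have s0 := numrange_diag 0 hM.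
have sn := upper_half_neq0 s0.
have [SZ ->] := trace_schur M' sn MZ.
pose a i := lift (@ord0 n) i.
rewrite ImD; apply: is_deriveD.
  exact: carg_deriv.
apply: IH SZ; first exact: numrange_schur.
move=> i j; under eq_fun do rewrite mxE.
have := cderivD (dM (a i) (a j)) (cderivN (cderivM (cderivM (dM (a i) 0) (dM 0 (a j)))
  (cderivV sn (dM 0 0)))).
congr (cderiv _ _ _); rewrite mxE /=; congr (_ - _); field.
exact: sn.
Qed.

(** Being in the sector [0 < Im a <= e Re a] passes from the numerical range to
    every pivot. *)
Lemma argsum_cvg0 n (T : Type) (F : set_system T) {FF : Filter F}
    (M : T -> 'M[R[i]]_n) (e : T -> R) :
  (\forall t \near F, 0 < e t /\
     numrange (M t) (fun a => 0 < Im a /\ Im a <= e t * Re a)) ->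
  e t @[t --> F] --> 0 -> argsum (M t) @[t --> F] --> 0.
Proof.
move=> hM e0; elim: n M hM => [|n IH] M hM; first exact: cvg_cst.
rewrite -[X in _ --> X]addr0; apply: cvgD.
  apply: carg_cvg0 e0; apply: filterS hM => t [et hM].
  by have [] := numrange_diag 0 hM.
apply: IH; apply: filterS hM => t [et hM]; split => //.
apply: numrange_schur => //; have [i0 _] := numrange_diag 0 hM.
exact: upper_half_neq0.
Qed.

(** At an invertible diagonal limit the off-diagonal products in the Schur
    complement vanish, so the pivots tend to the diagonal entries. *)
Lemma argsum_cvg n (T : Type) (F : set_system T) {FF : Filter F}
    (M : T -> 'M[R[i]]_n) (l : 'I_n -> R) :
  (\forall t \near F, numrange (M t) upper_half) ->
  (forall i, l i != 0) ->
  (forall i j, ccvg F (fun t => M t i j) (if i == j then (l i)%:C else 0)) ->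
  argsum (M t) @[t --> F] --> \sum_i (if l i < 0 then pi else 0).
Proof.
elim: n M l => [|n IH] M l hM l0 cM; first by rewrite big_ord0; exact: cvg_cst.
rewrite big_ord_recl; apply: cvgD.
  have [c1 c2] := cM 0 0; rewrite eqxx /= in c1 c2.
  apply: carg_cvg => //; apply: filterS hM => t hM.
  exact: numrange_diag hM.
apply: (IH _ (fun i => l (lift ord0 i))) => //.
  apply: filterS hM => t hM; apply: numrange_schur => //.
  exact: upper_half_neq0 (numrange_diag 0 hM).
move=> i j; under eq_fun do rewrite mxE.
have h : (if i == j then (l (lift ord0 i))%:C else 0 : R[i])
    = (if i == j then (l (lift ord0 i))%:C else 0) - 0 * 0 / (l 0)%:C.
  by rewrite mul0r mul0r subr0.
rewrite h; apply: ccvgD.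
  have := cM (lift ord0 i) (lift ord0 j).
  by rewrite (inj_eq lift_inj).
apply: ccvgN; apply: ccvgM; last first.
  apply: ccvgV; first by apply: contra (l0 0) => /eqP[->].
  exact: (cM 0 0).
apply: ccvgM; first exact: (cM (lift ord0 i) 0).
exact: (cM 0 (lift ord0 j)).
Qed.

End ArgSum.

(** * From complex differentiability to real paths *)

Section Bridge.
Context {R : realType}.

Lemma normc_ge_abs (z : R[i]) : (`|Re z|%:C <= `|z|) /\ (`|Im z|%:C <= `|z|).
Proof.
split; first exact: normc_ge_Re.
have -> : `|z| = `|z * 'i|.
  have i1 : `|'i : R[i]| = 1 by rewrite normc_def /= expr0n expr1n add0r sqrtr1.
  by rewrite normrM i1 mulr1.
by rewrite -(normrN (Im z)) -ReiNIm; exact: normc_ge_Re.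
Qed.

(** Componentwise convergence is convergence for the modulus, which metrizes the
    complex numbers as a normed space over themselves. *)
Lemma ccvgP (T : Type) (F : set_system T) {FF : Filter F} (f : T -> R[i]) (l : R[i]) :
  ccvg F f l <-> (f : T -> R[i]^o) t @[t --> F] --> (l : R[i]^o).
Proof.
split=> [[fr fi]|fl].
  apply/cvgrPdist_lt => e; rewrite ltcE => /andP[/eqP e0 e1].
  have e2 : 0 < Re e / 2 by rewrite divr_gt0.
  have /cvgrPdist_lt/(_ _ e2) nr := fr.
  have /cvgrPdist_lt/(_ _ e2) ni := fi.
  near=> t.
  have h1 : `|Re l - Re (f t)| < Re e / 2 by near: t.
  have h2 : `|Im l - Im (f t)| < Re e / 2 by near: t.
  rewrite ltcE normc_def /= e0 eqxx /=.
  have -> : Re e = Num.sqrt (Re e ^+ 2) by rewrite sqrtr_sqr gtr0_norm.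
  rewrite ltr_sqrt ?exprn_gt0 // !(ReD, ImD, ReN, ImN).
  rewrite -(real_normK (num_real (Re l - _))) -(real_normK (num_real (Im l - _))).
  have := normr_ge0 (Re l - Re (f t)); have := normr_ge0 (Im l - Im (f t)).
  by move: h1 h2; nra.
split; apply/cvgrPdist_lt => e e0; have e0' : 0 < e%:C :> R[i] by rewrite ltcR.
all: have /cvgrPdist_lt/(_ _ e0') nl := fl.
- near=> t; have h : `|(l : R[i]^o) - f t| < e%:C.
    by near: t.
  rewrite -ReN -ReD -ltcR; apply: le_lt_trans h; exact: (normc_ge_abs _).1.
- near=> t; have h : `|(l : R[i]^o) - f t| < e%:C.
    by near: t.
  rewrite -ImN -ImD -ltcR; apply: le_lt_trans h; exact: (normc_ge_abs _).2.
Unshelve. all: by end_near. Qed.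

Lemma derivable_ccvg (f : R[i] -> R[i]) (z : R[i]) (T : Type) (F : set_system T)
    {FF : Filter F} (g : T -> R[i]) :
  derivable (f : R[i]^o -> R[i]^o) z 1 -> ccvg F g z -> ccvg F (f \o g) (f z).
Proof.
move=> /derivable1_diffP /differentiable_continuous fz /ccvgP gz.
apply/ccvgP; exact: (cvg_comp _ _ gz fz).
Qed.

Lemma derivable_cderiv (f : R[i] -> R[i]) (x y : R) :
  derivable (f : R[i]^o -> R[i]^o) (x +i* y) 1 ->
  exists l, cderiv (fun t => f (t +i* y)) x l.
Proof.
move=> /cvg_ex[l hl]; exists l.
have h0 : (fun h : R => h%:C : R[i]^o) h @[h --> 0^'] --> (0 : R[i]^o)^'.
  move=> P; rewrite /dnbhs /within /= => hP.
  have c0 : ccvg (nbhs (0 : R)) (fun h => h%:C) 0.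
    by split => /=; [exact: cvg_id | exact: cvg_cst].
  have /ccvgP /(_ _ hP) H0 := c0.
  have H : nbhs (0 : R) (fun h => h%:C != 0 -> P h%:C) := H0.
  change (nbhs (0 : R) (fun h => h != 0 -> P h%:C)).
  apply: filterS H => h /= Ph h_neq0; apply: Ph.
  by apply: contra h_neq0 => /eqP[->].
have := cvg_comp _ _ h0 hl.
have -> : (fun h : R[i]^o => h^-1 *: ((f : R[i]^o -> R[i]^o) (h *: 1 + (x +i* y)) - f (x +i* y)))
     \o (fun h : R => h%:C) = (fun h => (h^-1)%:C * (f ((h + x) +i* y) - f (x +i* y))).
  apply/funext => h /=; rewrite /GRing.scale /= mulr1 fmorphV; congr (_ * (f _ - _)).
  by apply: complexP; rewrite ?ReD ?ImD /= ?add0r.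
move=> /ccvgP [h1 h2].
have mk (p : R[i] -> R) (l' : R) : (forall a b, p (a + b) = p a + p b) ->
   (forall a, p (- a) = - p a) -> (forall r a, p (r%:C * a) = r * p a) ->
   p ((h^-1)%:C * (f ((h + x) +i* y) - f (x +i* y))) @[h --> 0^'] --> l' ->
   is_derive x 1 (fun t => p (f (t +i* y))) l'.
  move=> pD pN pZ hp.
  have hp' : h^-1 *: (p (f ((h *: 1 + x) +i* y)) - p (f (x +i* y))) @[h --> 0^'] --> l'.
    apply: cvg_trans hp; apply: near_eq_cvg; near=> h.
    by rewrite pZ pD pN /GRing.scale /= mulr1.
  split; first by apply/cvg_ex; exists l'.
  exact: cvg_lim hp'.
split; apply: mk => //; [exact: ReD|exact: ReN| |exact: ImD|exact: ImN|].
- by move=> r a; rewrite ReM /= mul0r subr0.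
- by move=> r a; rewrite ImM /= mul0r addr0.
Unshelve. all: by end_near. Qed.

End Bridge.

(** * Boundary values of the density *)

Section MatrixLimits.
Context {R : realType} {T : Type} {F : set_system T} {FF : Filter F}.

Definition mxcvg m n (M : T -> 'M[R[i]]_(m, n)) (X : 'M[R[i]]_(m, n)) :=
  forall i j, ccvg F (fun t => M t i j) (X i j).

Lemma mxcvg_cst m n (X : 'M[R[i]]_(m, n)) : mxcvg (fun=> X) X.
Proof. by move=> i j; exact: ccvg_cst. Qed.

Lemma mxcvgD m n (M L : T -> 'M[R[i]]_(m, n)) X Y :
  mxcvg M X -> mxcvg L Y -> mxcvg (fun t => M t + L t) (X + Y).
Proof.
move=> MX LY i j; rewrite mxE; under eq_fun do rewrite mxE.
exact: ccvgD.
Qed.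

Lemma mxcvgM m n p (M : T -> 'M[R[i]]_(m, n)) (L : T -> 'M[R[i]]_(n, p)) X Y :
  mxcvg M X -> mxcvg L Y -> mxcvg (fun t => M t *m L t) (X *m Y).
Proof.
move=> MX LY i j; rewrite mxE; under eq_fun do rewrite mxE.
by apply: ccvg_sum => k; exact: ccvgM.
Qed.

Lemma mxcvg_scalar n (z : T -> R[i]) l : ccvg F z l ->
  mxcvg (fun t => (z t)%:M : 'M[R[i]]_n) l%:M.
Proof.
move=> zl i j; rewrite mxE; under eq_fun do rewrite mxE.
by case: (i == j); rewrite ?mulr1n // ?mulr0n; exact: ccvg_cst.
Qed.

Lemma mxcvg_kraus n (K : finType) (w : K -> 'M[R[i]]_n) (M : T -> 'M[R[i]]_n) X :
  mxcvg M X -> mxcvg (fun t => kraus w (M t)) (kraus w X).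
Proof.
move=> MX i j; rewrite /kraus summxE; under eq_fun do rewrite summxE.
apply: ccvg_sum => k; apply: mxcvgM; last exact: mxcvg_cst.
by apply: mxcvgM => //; exact: mxcvg_cst.
Qed.

Lemma mxcvg_trace n (M : T -> 'M[R[i]]_n) X :
  mxcvg M X -> ccvg F (fun t => \tr (M t)) (\tr X).
Proof. by move=> MX; apply: ccvg_sum => i. Qed.

Lemma mxcvg_qform n (M : T -> 'M[R[i]]_n) X v :
  mxcvg M X -> ccvg F (fun t => qform (M t) v) (qform X v).
Proof.
move=> MX; apply: mxcvgM; last exact: mxcvg_cst.
by apply: mxcvgM => //; exact: mxcvg_cst.
Qed.

Lemma ccvg_ntrace n (M : T -> 'M[R[i]]_n) X :
  mxcvg M X -> ccvg F (fun t => ntrace (M t)) (ntrace X).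
Proof. by move=> MX; apply: ccvgM; [exact: ccvg_cst|exact: mxcvg_trace]. Qed.

End MatrixLimits.
Arguments mxcvg {R T} F {m n} M X.

Lemma ccvg_unique (R : realType) (T : Type) (F : set_system T) {FF : ProperFilter F}
    (z : T -> R[i]) l m : ccvg F z l -> ccvg F z m -> l = m.
Proof.
move=> [l1 l2] [m1 m2]; apply: complexP.
  exact: (cvg_unique _ l1 m1).
exact: (cvg_unique _ l2 m2).
Qed.

Lemma ccvg_near_eq (R : realType) (T : Type) (F : set_system T) {FF : Filter F}
    (z y : T -> R[i]) l : (\forall t \near F, z t = y t) -> ccvg F z l -> ccvg F y l.
Proof.
move=> zy [z1 z2]; split.
  by apply: cvg_trans z1; apply: near_eq_cvg; apply: filterS zy => t ->.
by apply: cvg_trans z2; apply: near_eq_cvg; apply: filterS zy => t ->.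
Qed.

Section BoundaryValue.
Context {R : realType} {N : nat} {K : finType}.
Variables (w : K -> 'M[R[i]]_N) (A : 'M[R[i]]_N) (c C : R).
Hypothesis hN : (0 < N)%N.
Hypothesis hA : A^t* = A.
Hypothesis hc : 0 < c.
Let S := kraus w.
Hypothesis hflat : flat S c C.
Variable M : R[i] -> 'M[R[i]]_N.
Hypothesis hM : forall z, 0 < Im z -> mde_solution A S z (M z).
Hypothesis dM : forall z, 0 < Im z -> forall i j,
  derivable (fun w : R[i]^o => M w i j : R[i]^o) z 1.

Lemma upper_half_solution z : 0 < Im z -> numrange (M z) upper_half.
Proof.
move=> z0 v v0; have := (hM z0).2.2 v v0.
by rewrite -/(qform _ _) qform_immx complex_gt0 /= => /andP[].
Qed.

Lemma solution_hsnorm2 z : 0 < Im z -> hsnorm2 (M z) <= N%:R / c.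
Proof.
move=> z0; have [eM pV] := hM z0.
rewrite ler_pdivlMr // mulrC.
apply: (dyson_hsnorm2_le hN hA hflat eM) => //; first exact: ltW.
  exact: posdefmx_psdmx.
exact: posdefmx_trace.
Qed.

Let B := N%:R / c + 1.

Lemma solution_bounded z i j : 0 < Im z -> `|Re (M z i j)| <= B /\ `|Im (M z i j)| <= B.
Proof.
move=> z0; have := le_trans (hsnorm2_entry (M z) i j) (solution_hsnorm2 z0).
have k0 : 0 <= N%:R / c by rewrite divr_ge0 // ltW.
rewrite /B; set k := N%:R / c in k0 *; rewrite !ler_norml => h.
by split; apply/andP; split; nra.
Qed.

Lemma solution_mxcvg (T : Type) (F : set_system T) {FF : Filter F} (g : T -> R[i]) z :
  0 < Im z -> ccvg F g z -> mxcvg F (fun t => M (g t)) (M z).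
Proof. by move=> z0 gz i j; exact: (derivable_ccvg (@dM z z0 i j) gz). Qed.

Lemma Im_ntrace (X : 'M[R[i]]_N) : Im (ntrace X) = Re (ntrace (immx X)).
Proof.
rewrite ntrace_Re trace_immx /ntrace.
have -> : (N%:R : R[i]) = (N%:R : R)%:C by rewrite rmorph_nat.
by rewrite -fmorphV ImM /= mul0r addr0.
Qed.

(** The equation is polynomial in the entries and semidefiniteness is a closed
    condition. *)
Lemma dyson_limit (T : Type) (F : set_system T) {FF : ProperFilter F}
    (g : T -> R[i]) z (X : 'M[R[i]]_N) :
  (\forall t \near F, 0 < Im (g t)) -> ccvg F g z ->
  mxcvg F (fun t => M (g t)) X ->
  1%:M + dyson_op w A z X *m X = 0 /\ psdmx (immx X).
Proof.
move=> g0 gz MX; split.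
  have h : mxcvg F (fun t => 1%:M + dyson_op w A (g t) (M (g t)) *m M (g t))
     (1%:M + dyson_op w A z X *m X).
    apply: mxcvgD; first exact: mxcvg_cst.
    apply: mxcvgM => //; apply: mxcvgD; last exact: mxcvg_kraus.
    by apply: mxcvgD; [exact: mxcvg_scalar|exact: mxcvg_cst].
  apply/matrixP => i j; apply: (ccvg_unique (h i j)).
  apply: ccvg_near_eq (ccvg_cst _); apply: filterS g0 => t t0.
  by rewrite [in RHS](hM t0).1.
split; first by apply/hermP; exact: immx_adj.
move=> v; rewrite -/(qform _ _) qform_immx complex_ge0 /= eqxx /=.
have [_ h] := mxcvg_qform v MX.
apply: (cvgr_to_ge h); apply: filterS g0 => t t0.
have [->|v0] := eqVneq v 0; first by rewrite /qform mulmx0 mxE.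
exact/ltW/upper_half_solution.
Qed.

Lemma scdos_upper_bounded : exists b, forall z, 0 < Im z -> 0 < scdos_upper M z <= b.
Proof.
exists (pi^-1 * (N%:R^-1 * \sum_(i < N) B)) => z z0.
have pV := (@hM z z0).2.
have pi0 : 0 < pi^-1 :> R by rewrite invr_gt0 pi_gt0.
have N0 : 0 < N%:R^-1 :> R by rewrite invr_gt0 ltr0n.
rewrite /scdos_upper Im_ntrace ntrace_Re; apply/andP; split.
  by rewrite !mulr_gt0 // posdefmx_trace.
rewrite !ler_pM2l // trace_immx /= Im_sum; apply: ler_sum => i _.
apply: le_trans (ler_norm _) _.
exact: (@solution_bounded z i i z0).2.
Qed.

Variable x : R.

Let f (eta : R) : R := scdos_upper M (x +i* eta).

(** An ultrafilter on the levels [f eta = s] converging to 0 provides limits of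
    all the bounded entries at once.  Positivity of [s] and flatness then upgrade
    the semidefinite limit of [Im M] to a positive definite one. *)
Lemma density_attained s :
  (forall e, 0 < e -> exists eta, 0 < eta < e /\ f eta = s) ->
  exists X, [/\ 1%:M + dyson_op w A x%:C X *m X = 0, posdefmx (immx X) &
    pi^-1 * Im (ntrace X) = s].
Proof.
move=> hs.
pose G : set_system R := within (fun eta => f eta = s) 0^'+.
have GF : Filter G by exact: within_filter.
have GP : ProperFilter G.
  apply: Build_ProperFilter => -; rewrite /G /at_right /within /=.
  move=> /nbhs_ballP[e /= e0 he].
  have [eta [/andP[eta0 etae] fs]] := hs _ e0.
  apply: (he eta) => //.
  by rewrite /ball /= sub0r normrN gtr0_norm.
have [U [UU GU]] := ultraFilterLemma GP.
have UP : ProperFilter U by exact: ultra_proper.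
have U0 : \forall eta \near U, 0 < eta.
  apply: GU; rewrite /G /within /=; near=> t => _.
  by near: t; exact: nbhs_right_gt.
have Us : \forall eta \near U, f eta = s.
  by apply: GU; rewrite /G /within /=; near=> t.
have Ucvg : id @ U --> (0 : R).
  move=> V V0; apply: GU; rewrite /G /at_right /within /=.
  by apply: filterS V0 => t Vt _ _.
have limU (g : R -> R) : (\forall eta \near U, `|g eta| <= B) ->
    exists l : R, g eta @[eta --> U] --> l.
  move=> gB; have gB' : (g @ U) [set` `[- B, B]].
    by apply: filterS gB => t; rewrite ler_norml /= in_itv.
  have [l [_ cl]] := @segment_compact R (- B) B (g @ U) _ gB'.
  exists l => V Vl; have [//|UV] := in_ultra_setVsetC (g @^-1` V) UU.
  by have [y [/= nVy Vy]] := cl (~` V) V UV Vl.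
have [X MX] : exists X : 'M[R[i]]_N, mxcvg U (fun eta => M (x +i* eta)) X.
  have h i j : exists l, ccvg U (fun eta => M (x +i* eta) i j) l.
    have [|a Ha] := limU (fun eta => Re (M (x +i* eta) i j)).
      by apply: filterS U0 => eta eta0; have [] := @solution_bounded (x +i* eta) i j eta0.
    have [|b Hb] := limU (fun eta => Im (M (x +i* eta) i j)).
      by apply: filterS U0 => eta eta0; have [] := @solution_bounded (x +i* eta) i j eta0.
    by exists (a +i* b).
  exact: mx_choice h.
have xU : ccvg U (fun eta => x +i* eta) x%:C.
  by split => /=; [exact: cvg_cst|exact: Ucvg].
have [eX pX] := dyson_limit U0 xU MX.
have sX : pi^-1 * Im (ntrace X) = s.
  have h : f eta @[eta --> U] --> pi^-1 * Im (ntrace X).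
    by apply: cvgM; [exact: cvg_cst|exact: (ccvg_ntrace MX).2].
  apply: (cvg_unique (@norm_hausdorff _ _) h).
  have cs : (fun=> s) @ U --> s by exact: cvg_cst.
  by apply: cvg_trans cs; apply: near_eq_cvg; apply: filterS Us => t ->.
exists X; split => //; split; first by apply/hermP; exact: immx_adj.
have s0 : 0 < Im (ntrace X).
  have [eta [/andP[eta0 _] fs]] := hs 1 ltr01.
  have : 0 < s.
    rewrite -fs /f /scdos_upper mulr_gt0 ?invr_gt0 ?pi_gt0 // Im_ntrace ntrace_Re.
    by rewrite mulr_gt0 ?invr_gt0 ?ltr0n // posdefmx_trace //; exact: (hM _).2.
  by rewrite -sX pmulr_rgt0 // invr_gt0 pi_gt0.
move=> v v0; rewrite -/(qform _ _) qform_immx complex_gt0 /= eqxx /=.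
rewrite (Im_qform_dyson hA eX) /= mul0r add0r.
apply: lt_le_trans (flat_lower hflat _ pX).
rewrite !mulr_gt0 -?Im_ntrace // lt_neqAle nsq_ge0 andbT eq_sym.
apply: contra v0 => /eqP Xv; have /sqnorm_eq0 Xv0 : sqnorm (X *m v) = 0.
  by rewrite sqnorm_nsq Xv.
apply/eqP; rewrite -[v]mul1mx -[1%:M]opprK -(dyson_mulr eX) mulNmx -mulmxA Xv0.
by rewrite mulmx0 oppr0.
Unshelve. all: by end_near. Qed.

Lemma f_continuous eta : 0 < eta -> {for eta, continuous f}.
Proof.
move=> eta0; have g : ccvg (nbhs eta) (fun t => x +i* t) (x +i* eta).
  by split => /=; [exact: cvg_cst|exact: cvg_id].
have h : mxcvg (nbhs eta) (fun t => M (x +i* t)) (M (x +i* eta)).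
  by apply: solution_mxcvg.
by apply: cvgM; [exact: cvg_cst|exact: (ccvg_ntrace h).2].
Qed.

(** Two cluster values [q1 < q2] would make every value in between attained
    arbitrarily close to 0, contradicting the uniqueness of the solution at [x]
    for two such values. *)
Lemma density_cvg : cvg (f eta @[eta --> 0^'+]).
Proof.
have [b fb'] := scdos_upper_bounded.
have fb eta : 0 < eta -> 0 < f eta <= b by move=> h; exact: fb'.
pose G := f @ 0^'+.
have GV : G [set` `[- (b + 1), b + 1]].
  rewrite /G /=; near=> t; have t0 : 0 < t by near: t; exact: nbhs_right_gt.
  have /andP[f0 fle] := fb _ t0; rewrite /= in_itv /=; apply/andP; split; lra.
have GP : ProperFilter G by apply: fmap_proper_filter.
have [p [pV pG]] := @segment_compact R (- (b + 1)) (b + 1) G GP GV.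
have small (V : set R) q e : cluster G q -> nbhs q V -> 0 < e ->
    exists eta, 0 < eta < e /\ V (f eta).
  move=> cq qV e0.
  have [|y [[eta eE <-] Vy]] := cq (f @` [set eta | 0 < eta < e]) V _ qV.
    rewrite /G /=; near=> t; exists t => //=; apply/andP; split; near: t.
      exact: nbhs_right_gt.
    exact: nbhs_right_lt.
  by exists eta.
have order q1 q2 : cluster G q1 -> cluster G q2 -> ~ q1 < q2.
  move=> c1 c2 q12.
  have attained s : q1 < s -> s < q2 ->
      forall e, 0 < e -> exists eta, 0 < eta < e /\ f eta = s.
    move=> q1s sq2 e e0.
    have [e1 [/andP[e10 e1e] f1]] := small _ _ _ c1 (lt_nbhsl q1s) e0.
    have [e2 [/andP[e20 e2e] f2]] := small _ _ _ c2 (lt_nbhsr sq2) e0.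
    have ivt u v : 0 < u -> v < e -> u <= v ->
        Num.min (f u) (f v) <= s <= Num.max (f u) (f v) ->
        exists eta, 0 < eta < e /\ f eta = s.
      move=> u0 ve uv sf; have [|y] := @IVT R f u v s uv _ sf.
        apply: continuous_in_subspaceT => y; rewrite inE /= in_itv /= => /andP[uy _].
        by apply: f_continuous; exact: lt_le_trans uy.
      rewrite in_itv /= => /andP[uy yv] fy; exists y; split => //.
      by rewrite (lt_le_trans u0 uy) (le_lt_trans yv ve).
    have [e12|/ltW e12] := leP e1 e2.
      by apply: (ivt e1 e2) => //; rewrite ge_min le_max (ltW f1) (ltW f2) orbT.
    by apply: (ivt e2 e1) => //; rewrite ge_min le_max (ltW f1) (ltW f2) orbT.
  pose s := (2 * q1 + q2) / 3; pose t := (q1 + 2 * q2) / 3.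
  have [||X [eX pX Xs]] := density_attained (attained s _ _); [rewrite /s; lra..|].
  have [||Y [eY pY Yt]] := density_attained (attained t _ _); [rewrite /t; lra..|].
  have XY := dyson_real_unique hN hA hc hflat eX eY pX pY.
  have : s = t by rewrite -Xs -Yt XY.
  rewrite /s /t; lra.
apply/cvg_ex; exists p.
apply: (@compact_cluster_set1 R p G [set` `[- (b + 1), b + 1]]) => //.
- exact: segment_compact.
- have [pb1 pb2] : 0 <= p /\ p <= b.
    split; rewrite leNgt; apply/negP => h.
      have [e [/andP[e0 _] fe]] := small _ _ _ pG (lt_nbhsl h) ltr01.
      by have := fb _ e0; rewrite (ltNge 0) (ltW fe).
    have [e [/andP[e0 _] fe]] := small _ _ _ pG (lt_nbhsr h) ltr01.
    by have := fb _ e0; rewrite (leNgt _ b) fe andbF.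
  near=> y; rewrite /= in_itv /=; apply/andP; split; apply: ltW; near: y.
    by apply: lt_nbhsr; lra.
  by apply: lt_nbhsl; lra.
- apply/seteqP; split => [q cq|q ->//] /=.
  apply/eqP; rewrite eq_le; apply/andP; split; rewrite leNgt; apply/negP; exact: order.
Unshelve. all: by end_near. Qed.

Lemma scdosP : scdos_upper M (x +i* eta) @[eta --> 0^'+] --> scdos M x.
Proof. exact: density_cvg. Qed.

End BoundaryValue.

(** * Differentiating matrices and counting eigenvalues *)

Section MatrixDerivative.
Context {R : realType}.
Implicit Types x : R.

Definition mxcderiv m n (M : R -> 'M[R[i]]_(m, n)) x (M' : 'M[R[i]]_(m, n)) :=
  forall i j, cderiv (fun t => M t i j) x (M' i j).

Lemma mxcderiv_cst m n (X : 'M[R[i]]_(m, n)) x : mxcderiv (fun=> X) x 0.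
Proof. by move=> i j; rewrite mxE; exact: cderiv_cst. Qed.

Lemma mxcderivD m n (M L : R -> 'M[R[i]]_(m, n)) x M' L' :
  mxcderiv M x M' -> mxcderiv L x L' -> mxcderiv (fun t => M t + L t) x (M' + L').
Proof.
move=> hM hL i j; rewrite mxE; under eq_fun do rewrite mxE; exact: cderivD.
Qed.

Lemma mxcderivM m n p (M : R -> 'M[R[i]]_(m, n)) (L : R -> 'M[R[i]]_(n, p)) x M' L' :
  mxcderiv M x M' -> mxcderiv L x L' ->
  mxcderiv (fun t => M t *m L t) x (M' *m L x + M x *m L').
Proof.
move=> hM hL i j; rewrite !mxE -big_split /=; under eq_fun do rewrite mxE.
by apply: cderiv_sum => k; exact: cderivM.
Qed.

Lemma mxcderiv_mulmx n (U V : 'M[R[i]]_n) (M : R -> 'M[R[i]]_n) x M' :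
  mxcderiv M x M' -> mxcderiv (fun t => U *m M t *m V) x (U *m M' *m V).
Proof.
move=> hM.
have := mxcderivM (mxcderivM (mxcderiv_cst U x) hM) (mxcderiv_cst V x).
by rewrite mul0mx add0r mulmx0 addr0.
Qed.

Lemma mxcderiv_kraus n (K : finType) (w : K -> 'M[R[i]]_n) (M : R -> 'M[R[i]]_n) x M' :
  mxcderiv M x M' -> mxcderiv (fun t => kraus w (M t)) x (kraus w M').
Proof.
move=> hM i j; rewrite /kraus summxE; under eq_fun do rewrite summxE.
by apply: cderiv_sum => k; exact: mxcderiv_mulmx.
Qed.

Lemma mxcderiv_trace n (M : R -> 'M[R[i]]_n) x M' :
  mxcderiv M x M' -> cderiv (fun t => \tr (M t)) x (\tr M').
Proof. by move=> hM; apply: cderiv_sum => i. Qed.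

Lemma cderiv_unique (f : R -> R[i]) x l m : cderiv f x l -> cderiv f x m -> l = m.
Proof.
move=> [l1 l2] [m1 m2]; apply: complexP.
  by rewrite -(@derive_val _ _ _ _ _ _ _ l1) -(@derive_val _ _ _ _ _ _ _ m1).
by rewrite -(@derive_val _ _ _ _ _ _ _ l2) -(@derive_val _ _ _ _ _ _ _ m2).
Qed.

Lemma mxcderiv_scalar n (f : R -> R[i]) x l : cderiv f x l ->
  mxcderiv (fun t => (f t)%:M : 'M[R[i]]_n) x l%:M.
Proof.
move=> hf i j; rewrite mxE; under eq_fun do rewrite mxE.
by case: (i == j); rewrite ?mulr1n // ?mulr0n; exact: cderiv_cst.
Qed.

End MatrixDerivative.

Section Spectrum.
Context {R : realType}.

Lemma char_poly_conj (F : fieldType) n (P Q D : 'M[F]_n) : Q *m P = 1%:M ->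
  char_poly (Q *m D *m P) = char_poly D.
Proof.
move=> QP; pose f := map_mx (@polyC F) : 'M[F]_n -> 'M[{poly F}]_n.
have fM (X Y : 'M[F]_n) : f (X *m Y) = f X *m f Y by exact: map_mxM.
have fQP : f Q *m f P = 1%:M by rewrite -fM QP /f map_mx1.
rewrite /char_poly.
have -> : char_poly_mx (Q *m D *m P) = f Q *m char_poly_mx D *m f P.
  rewrite /char_poly_mx -!/(f _) !fM mulmxBr mulmxBl; congr (_ - _).
  by rewrite mul_mx_scalar -scalemxAl fQP scalemx1.
rewrite !det_mulmx mulrAC -det_mulmx fQP det1 mul1r //.
Qed.

Lemma num_neg_eigenvalues_diag n (P : 'M[R[i]]_n) (l : 'I_n -> R) X :
  P^t* *m P = 1%:M ->
  X = P^t* *m diag_mx (\row_i (l i)%:C) *m P ->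
  ((num_neg_eigenvalues X)%:R = \sum_i (if l i < 0 then 1 else 0) :> R).
Proof.
move=> PP XE.
have e : perm_eq (spectrum X) [seq (l i)%:C | i <- index_enum 'I_n].
  apply: prod_XsubC_eq; rewrite big_map.
  have := svalP (closed_field_poly_normal (char_poly X)).
  rewrite -/(spectrum X) (monicP (char_poly_monic X)) scale1r => <-.
  rewrite XE char_poly_conj // char_poly_trig ?diag_mx_is_trig //.
  by apply: eq_bigr => i _; rewrite !mxE eqxx mulr1n.
rewrite /num_neg_eigenvalues (permP e) count_map -sum1_count natr_sum.
rewrite big_mkcond /=; apply: eq_bigr => i _.
by rewrite ltcE /= eqxx.
Qed.

End Spectrum.

(** * The mass of the density below a point off its support *)

Lemma harmonic_at_right (R : realType) : (@harmonic R) n @[n --> \oo] --> (0 : R)^'+.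
Proof.
move=> V; rewrite /at_right /within /= => V0.
have H : \forall n \near \oo, (0 : R) < harmonic n -> V (harmonic n).
  exact: (@cvg_harmonic R) _ V0.
change (\forall n \near \oo, V (@harmonic R n)).
by apply: filterS H => n h; apply: h; exact: harmonic_gt0.
Qed.

Section BandMass.
Context {R : realType} {N : nat} {K : finType}.
Variables (w : K -> 'M[R[i]]_N) (A : 'M[R[i]]_N) (c C : R).
Hypothesis hN : (0 < N)%N.
Hypothesis hA : A^t* = A.
Hypothesis hc : 0 < c.
Hypothesis hC : 0 < C.
Let S := kraus w.
Hypothesis hflat : flat S c C.
Hypothesis htr : forall X Y, \tr (S X *m Y) = \tr (X *m S Y).
Variable M : R[i] -> 'M[R[i]]_N.
Hypothesis hM : forall z, 0 < Im z -> mde_solution A S z (M z).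
Hypothesis dM : forall z, 0 < Im z -> forall i j,
  derivable (fun w : R[i]^o => M w i j : R[i]^o) z 1.

Lemma numrange_unitary n (U X : 'M[R[i]]_n) p : U *m U^t* = 1%:M ->
  numrange X p -> numrange (U *m X *m U^t*) p.
Proof.
move=> UU h v v0; rewrite -{1}[U]trmxCK qform_congr; apply: h.
apply: contra v0 => /eqP Uv; rewrite -[v]mul1mx -UU -mulmxA Uv.
by rewrite mulmx0.
Qed.

(** The imaginary part of [log det X - tr (S[X] X) / 2], with the determination of
    the argument seen in the basis given by [U]. *)
Definition potential (U X : 'M[R[i]]_N) : R :=
  argsum (U *m X *m U^t*) - 2^-1 * Im (\tr (S X *m X)).

(** With [m] and [m'] the solution and its derivative, differentiating the Dyson
    equation gives [(1 + S[m']) m + Y m' = 0] with [m^-1 = - Y]; hence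
    [tr (m^-1 m') = tr m + tr (S[m'] m)], and the last term is half the
    derivative of [tr (S[m] m)] because S is self-adjoint. *)
Lemma potential_deriv (U : 'M[R[i]]_N) (eta x : R) : U *m U^t* = 1%:M -> 0 < eta ->
  is_derive x 1 (fun t => potential U (M (t +i* eta))) (Im (\tr (M (x +i* eta)))).
Proof.
move=> UU eta0; have UU' : U^t* *m U = 1%:M by apply: mulmx1C.
pose m t := M (t +i* eta).
have eM t : 1%:M + dyson_op w A (t +i* eta) (m t) *m m t = 0.
  exact: (@hM (t +i* eta) eta0).1.
have [m' hm'] : exists m', mxcderiv m x m'.
  have h i j : exists l, cderiv (fun t => m t i j) x l.
    exact: (@derivable_cderiv _ (fun w => M w i j) x eta (@dM (x +i* eta) eta0 i j)).
  exact: mx_choice h.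
set Y := dyson_op w A (x +i* eta) (m x).
have hz : cderiv (fun t => t +i* eta) x 1.
  by split => /=; [exact: is_derive_id|exact: is_derive_cst].
have dY : mxcderiv (fun t => dyson_op w A (t +i* eta) (m t)) x (1%:M + S m').
  rewrite -[1%:M]addr0; apply: mxcderivD; last exact: mxcderiv_kraus.
  by apply: mxcderivD; [exact: mxcderiv_scalar|exact: mxcderiv_cst].
have mE : (1%:M + S m') *m m x + Y *m m' = 0.
  have h := mxcderivD (mxcderiv_cst 1%:M x) (mxcderivM dY hm').
  rewrite -[LHS]add0r; apply/matrixP => i j.
  apply: (cderiv_unique (h i j)).
  under eq_fun do rewrite eM.
  exact: mxcderiv_cst.
pose Z := U *m (- Y) *m U^t*.
have mZ : (U *m m x *m U^t*) *m Z = 1%:M.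
  rewrite /Z !mulmxA -(mulmxA (U *m m x)) UU' mulmx1 -(mulmxA U) mulmxN.
  by rewrite (dyson_mull (eM x)) opprK mulmx1.
have nr : numrange (U *m m x *m U^t*) upper_half.
  by apply: numrange_unitary => //; exact: (upper_half_solution hM).
have d1 := argsum_deriv nr (mxcderiv_mulmx U (U^t*) hm') mZ.
have [_ d2] := mxcderiv_trace (mxcderivM (mxcderiv_kraus w hm') hm').
have d3 := is_deriveB d1 (is_deriveM (is_derive_cst (2^-1 : R) x 1) d2).
apply: is_derive_eq d3 _.
rewrite /GRing.scale /= mulr0 addr0.
have -> : \tr (Z *m (U *m m' *m U^t*)) = - \tr (Y *m m').
  rewrite /Z !mulmxA -(mulmxA (U *m - Y)) UU' mulmx1 mxtrace_mulC !mulmxA UU' mul1mx.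
  by rewrite mulNmx raddfN.
have -> : \tr (Y *m m') = - \tr (m x) - \tr (S m' *m m x).
  have /(congr1 mxtrace) := mE; rewrite mulmxDl mul1mx !mxtraceD mxtrace0.
  by move/eqP; rewrite addr_eq0 => /eqP e; rewrite -[RHS]opprD e opprK.
have -> : \tr (kraus w m' *m m x + kraus w (m x) *m m') = 2 * \tr (S m' *m m x).
  rewrite raddfD /= [X in _ + X]mxtrace_mulC -htr /S; ring.
by rewrite mulr_natl mulr2n !(ImN, ImD) -/(m x); field.
Qed.

Lemma scdos_upperE (z : R[i]) : scdos_upper M z = (pi * N%:R)^-1 * Im (\tr (M z)).
Proof.
rewrite /scdos_upper Im_ntrace // ntrace_Re // trace_immx /=.
by rewrite invfM mulrA.
Qed.

Lemma scdos_upper_FTC (U : 'M[R[i]]_N) (eta a b : R) : U *m U^t* = 1%:M -> 0 < eta -> a < b ->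
  (\int[lebesgue_measure]_(x in `[a, b]) (scdos_upper M (x +i* eta))%:E =
   ((pi * N%:R)^-1 * (potential U (M (b +i* eta)) - potential U (M (a +i* eta))))%:E)%E.
Proof.
move=> UU eta0 ab.
pose k : R := (pi * N%:R)^-1.
pose F t := k * potential U (M (t +i* eta)).
have dF (x : R) : is_derive x 1 F (scdos_upper M (x +i* eta)).
  rewrite scdos_upperE.
  have h := is_deriveM (is_derive_cst k x 1) (potential_deriv x UU eta0).
  by apply: is_derive_eq h _; rewrite /GRing.scale /= mulr0 addr0.
have cF : continuous F.
  by move=> x; apply/differentiable_continuous/derivable1_diffP; case: (dF x).
have cf : continuous (fun x => scdos_upper M (x +i* eta)).
  move=> x; have g : ccvg (nbhs x) (fun t => t +i* eta) (x +i* eta).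
    by split => /=; [exact: cvg_id|exact: cvg_cst].
  have h : mxcvg (nbhs x) (fun t => M (t +i* eta)) (M (x +i* eta)).
    exact: (solution_mxcvg dM).
  by apply: cvgM; [exact: cvg_cst|exact: (ccvg_ntrace h).2].
rewrite (@continuous_FTC2 _ _ F) //.
- by rewrite -EFinB /F -mulrBr.
- exact: continuous_subspaceT.
- split.
  + by move=> x _; case: (dF x).
  + by apply: cvg_at_right_filter; exact: cF.
  + by apply: cvg_at_left_filter; exact: cF.
- by move=> x _; rewrite derive1E; exact: (@derive_val _ _ _ _ _ _ _ (dF x)).
Qed.

Lemma scdos_integral (U : 'M[R[i]]_N) (a b pa pb : R) : U *m U^t* = 1%:M -> a < b ->
  potential U (M (a +i* eta)) @[eta --> 0^'+] --> pa ->
  potential U (M (b +i* eta)) @[eta --> 0^'+] --> pb ->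
  (\int[lebesgue_measure]_(x in `[a, b]) (scdos M x)%:E =
   ((pi * N%:R)^-1 * (pb - pa))%:E)%E.
Proof.
move=> UU ab ha hb.
have [B hB] := scdos_upper_bounded hN hA hc hflat hM.
pose e n : R := harmonic n.
have e0 n : 0 < e n by exact: harmonic_gt0.
pose gn n (x : R) : R := scdos_upper M (x +i* e n).
have cvgf (x : R) : (gn n x)%:E @[n --> \oo] --> (scdos M x)%:E.
  apply: cvg_EFin; first by near=> n.
  exact: (cvg_comp _ _ (@harmonic_at_right R) (scdosP hN hA hc hflat hM dM (x := x))).
have mf n : measurable_fun `[a, b] (EFin \o gn n).
  apply/measurable_EFinP; apply: measurable_funTS; apply: continuous_measurable_fun.
  move=> x; have g : ccvg (nbhs x) (fun t => t +i* e n) (x +i* e n).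
    by split => /=; [exact: cvg_id|exact: cvg_cst].
  have h : mxcvg (nbhs x) (fun t => M (t +i* e n)) (M (x +i* e n)).
    by apply: (solution_mxcvg dM) => //=.
  by apply: cvgM; [exact: cvg_cst|exact: (ccvg_ntrace h).2].
have mfl : measurable_fun `[a, b] (EFin \o scdos M).
  by apply: emeasurable_fun_cvg mf _ => x _; exact: cvgf.
have gB : lebesgue_measure.-integrable `[a, b] (EFin \o cst B).
  apply: continuous_compact_integrable; first exact: segment_compact.
  by apply: continuous_subspaceT => x; exact: cvg_cst.
have ae1 : {ae lebesgue_measure, forall x : R, `[a, b]%classic x ->
    (EFin \o gn n) x @[n --> \oo] --> (EFin \o scdos M) x}.
  by apply: aeW => x _; exact: cvgf.
have ae2 : {ae lebesgue_measure, forall (x : R) n, `[a, b]%classic x ->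
    (`|(EFin \o gn n) x| <= (EFin \o cst B) x)%E}.
  apply: aeW => x n _; rewrite /gn /= lee_fin.
  have /andP[f0 fB] := hB (x +i* e n) (e0 n).
  by rewrite gtr0_norm.
have [_ _ lim1] := @dominated_convergence _ _ R (@lebesgue_measure R) _ (measurable_itv _)
  (fun n => EFin \o gn n) _ _ mf mfl ae1 gB ae2.
apply: (cvg_unique (@ereal_hausdorff R) lim1).
rewrite (_ : [sequence _]_n = (fun n => ((pi * N%:R)^-1 *
    (potential U (M (b +i* e n)) - potential U (M (a +i* e n))))%:E)); last first.
  by apply/funext => n; exact: (scdos_upper_FTC UU (e0 n) ab).
apply: cvg_EFin; first by near=> n.
apply: cvgM; first exact: cvg_cst.
apply: cvgB.
  exact: (cvg_comp _ _ (@harmonic_at_right R) hb).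
exact: (cvg_comp _ _ (@harmonic_at_right R) ha).
Unshelve. all: by end_near. Qed.

Lemma trace_kraus_hermitian X : X^t* = X -> Im (\tr (S X *m X)) = 0.
Proof.
move=> hX; have : Num.conj (\tr (S X *m X)) = \tr (S X *m X).
  have trJ (Y : 'M[R[i]]_N) : Num.conj (\tr Y) = \tr (Y^t*).
    by rewrite /mxtrace rmorph_sum /=; apply: eq_bigr => i _; rewrite !mxE.
  by rewrite trJ adjM hX kraus_adj hX mxtrace_mulC.
move=> /(congr1 (@complex.Im R)); rewrite ImJ => h; lra.
Qed.

Lemma ccvg_vertical (x : R) : ccvg (0 : R)^'+ (fun eta => x +i* eta) x%:C.
Proof.
split => /=; first exact: cvg_cst.
by apply: cvg_at_right_filter; exact: cvg_id.
Qed.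

(** Where the density vanishes the limit of [Im M] is positive semidefinite with
    trace 0. *)
Lemma boundary_value (x : R) :
  (forall i j, derivable (fun w : R[i]^o => M w i j : R[i]^o) x%:C 1) ->
  scdos M x = 0 ->
  [/\ mxcvg (0 : R)^'+ (fun eta => M (x +i* eta)) (M x%:C),
      1%:M + dyson_op w A x%:C (M x%:C) *m M x%:C = 0 & (M x%:C)^t* = M x%:C].
Proof.
move=> dx s0.
have Mx : mxcvg (0 : R)^'+ (fun eta => M (x +i* eta)) (M x%:C).
  by move=> i j; exact: (derivable_ccvg (dx i j) (ccvg_vertical x)).
have im0 : \forall eta \near (0 : R)^'+, 0 < Im (x +i* eta).
  by near=> eta; near: eta; exact: nbhs_right_gt.
have [eX [hV pV]] := dyson_limit hM im0 (ccvg_vertical x) Mx.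
split => //.
have tr0 : Im (ntrace (M x%:C)) = 0.
  have h1 := (ccvg_ntrace Mx).2.
  have h2 := scdosP hN hA hc hflat hM dM (x := x).
  have h3 : scdos_upper M (x +i* eta) @[eta --> 0^'+] --> pi^-1 * Im (ntrace (M x%:C)).
    by apply: cvgM; [exact: cvg_cst|exact: h1].
  have : pi^-1 * Im (ntrace (M x%:C)) = 0.
    by rewrite -s0; apply: (cvg_unique (@norm_hausdorff _ _) h3).
  move=> /eqP.
  by rewrite mulf_eq0 invr_eq0 gt_eqF ?pi_gt0 //= => /eqP.
have V0 : immx (M x%:C) = 0.
  apply: psd_trace_eq0; [exact: immx_adj|exact: pV|].
  rewrite trace_immx; congr (_%:C).
  have := tr0; rewrite Im_ntrace // ntrace_Re // trace_immx /= => /eqP.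
  by rewrite mulf_eq0 invr_eq0 pnatr_eq0 -leqn0 leqNgt hN /= => /eqP.
apply/eqP; rewrite eq_sym -subr_eq0; apply/eqP.
have := congr1 (fun X => (2 * 'i) *: X) V0.
rewrite /immx scalerA scaler0 divff ?scale1r //.
by apply/eqP => -[/eqP]; rewrite /= ?mulr0 ?mul0r ?subrr; lra.
Unshelve. all: by end_near. Qed.

(** [U] diagonalizes the boundary value, as [argsum_cvg] requires, and 0 is not an
    eigenvalue because the Dyson equation inverts the boundary value. *)
Lemma potential_right (x : R) :
  (forall i j, derivable (fun w : R[i]^o => M w i j : R[i]^o) x%:C 1) ->
  scdos M x = 0 ->
  exists2 U, U *m U^t* = 1%:M &
    potential U (M (x +i* eta)) @[eta --> 0^'+] -->
      pi * (num_neg_eigenvalues (M x%:C))%:R.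
Proof.
move=> dx s0; have [Mx eX hX] := boundary_value dx s0.
have [P [D [PP PP' Dr XE]]] := spectral_hermitian hX.
pose l i := Re (D 0 i).
have Dl : D = \row_i (l i)%:C.
  by apply/rowP => i; rewrite mxE /l RRe_real //; exact: (mxOverP Dr).
have l0 i : l i != 0.
  apply/eqP => li; have : M x%:C *m (P^t* *m delta_mx i 0) = 0 :> 'cV_N.
    rewrite XE mulmxA -(mulmxA (_ *m diag_mx D)) PP mulmx1 -mulmxA.
    suff -> : diag_mx D *m delta_mx i 0 = 0 :> 'cV_N by rewrite mulmx0.
    apply/colP => j; rewrite mul_diag_mx !mxE.
    have [->|_] := eqVneq j i; last by rewrite mulr0.
    by rewrite Dl mxE li mul0r.
  move=> /(congr1 (mulmx (dyson_op w A x%:C (M x%:C)))).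
  rewrite mulmxA (dyson_mulr eX) mulmx0 mulNmx mul1mx => /eqP.
  rewrite oppr_eq0 => /eqP /(congr1 (mulmx P)); rewrite mulmxA PP mul1mx mulmx0.
  by apply/eqP; exact: delta_neq0.
exists P => //.
have -> : pi * (num_neg_eigenvalues (M x%:C))%:R
    = \sum_i (if l i < 0 then pi else 0) - 2^-1 * Im (\tr (S (M x%:C) *m M x%:C)).
  rewrite trace_kraus_hermitian // mulr0 subr0.
  rewrite (num_neg_eigenvalues_diag PP' (l := l)) -?Dl // mulr_sumr.
  by apply: eq_bigr => i _; case: ifP => _; rewrite ?mulr1 ?mulr0.
apply: cvgB; last first.
  apply: cvgM; first exact: cvg_cst.
  by have [_] := mxcvg_trace (mxcvgM (mxcvg_kraus w Mx) Mx).
apply: argsum_cvg => //.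
  near=> eta; apply: numrange_unitary => //; apply: (upper_half_solution hM).
  by near: eta; exact: nbhs_right_gt.
move=> i j.
have lE : (P *m M x%:C *m P^t*) i j = if i == j then (l i)%:C else 0.
  rewrite XE !mulmxA PP mul1mx -mulmxA PP mulmx1 mxE Dl mxE.
  by case: eqP => _; rewrite ?mulr1n ?mulr0n.
rewrite -lE; apply: mxcvgM; last exact: mxcvg_cst.
by apply: mxcvgM => //; exact: mxcvg_cst.
Unshelve. all: by end_near. Qed.

(** By [dyson_left_end] the numerical range lies in a sector around the positive
    axis whose opening is of order [eta]. *)
Lemma left_end : exists a0 : R, forall a, a <= a0 -> scdos M a = 0 /\
  forall U : 'M[R[i]]_N, U *m U^t* = 1%:M ->
    argsum (U *m M (a +i* eta) *m U^t*) @[eta --> 0^'+] --> 0.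
Proof.
have [a0 ha0] := dyson_left_end hN hA hc hC hflat.
have id0 : (fun eta : R => eta) @ (0 : R)^'+ --> (0 : R).
  by apply: cvg_at_right_filter; exact: cvg_id.
exists a0 => a aa0.
have ha eta (eta0 : 0 < eta) := ha0 (a +i* eta) _ aa0 eta0 (hM (z := a +i* eta) eta0).
split.
  have h2 := scdosP hN hA hc hflat hM dM (x := a).
  apply: (cvg_unique (@norm_hausdorff _ _) h2).
  have h0 : pi^-1 * eta @[eta --> (0 : R)^'+] --> (0 : R).
    by rewrite -[X in _ --> X](mulr0 pi^-1); apply: cvgM; [exact: cvg_cst|exact: id0].
  have [B hB] := scdos_upper_bounded hN hA hc hflat hM.
  apply: (squeeze_cvgr _ (cvg_cst 0) h0).
  near=> eta; have eta0 : 0 < eta by near: eta; exact: nbhs_right_gt.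
  have /andP[f0 _] := hB (a +i* eta) eta0; rewrite (ltW f0) /=.
  rewrite /scdos_upper Im_ntrace // ler_pM2l ?invr_gt0 ?pi_gt0 //.
  exact: (ha eta eta0).1.
move=> U UU; apply: (@argsum_cvg0 _ _ _ _ _ _ (fun eta => (1 + C) * eta)).
  near=> eta; have eta0 : 0 < eta by near: eta; exact: nbhs_right_gt.
  split; first by rewrite mulr_gt0 // addr_gt0.
  apply: numrange_unitary => // v v0; split.
    exact: (upper_half_solution hM).
  exact: (ha eta eta0).2.
by rewrite -[X in _ --> X](mulr0 (1 + C)); apply: cvgM; [exact: cvg_cst|exact: id0].
Unshelve. all: by end_near. Qed.

Lemma potential_left (U : 'M[R[i]]_N) (a : R) :
  (forall i j, derivable (fun w : R[i]^o => M w i j : R[i]^o) a%:C 1) ->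
  scdos M a = 0 ->
  argsum (U *m M (a +i* eta) *m U^t*) @[eta --> 0^'+] --> 0 ->
  potential U (M (a +i* eta)) @[eta --> 0^'+] --> 0.
Proof.
move=> da s0 hU; have [Mx _ hX] := boundary_value da s0.
have e0 : (0 : R) = 0 - 2^-1 * Im (\tr (S (M a%:C) *m M a%:C)).
  by rewrite trace_kraus_hermitian // mulr0 subr0.
rewrite [X in _ --> X]e0; apply: cvgB => //; apply: cvgM; first exact: cvg_cst.
by have [_] := mxcvg_trace (mxcvgM (mxcvg_kraus w Mx) Mx).
Qed.

Hypothesis dMr : forall x : R, ~ supp (scdos M) x -> forall i j,
  derivable (fun w : R[i]^o => M w i j : R[i]^o) x%:C 1.

Lemma scdos_off_supp (x : R) : ~ supp (scdos M) x -> scdos M x = 0.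
Proof.
move=> nx; apply/eqP/negPn/negP => sx; apply: nx; exact: subset_closure.
Qed.

Lemma band_mass (tau : R) : ~ supp (scdos M) tau ->
  (\int[lebesgue_measure]_(x in `]-oo, tau]) (scdos M x)%:E
     = ((num_neg_eigenvalues (M tau%:C))%:R / N%:R)%:E)%E.
Proof.
move=> ntau; have [a0 ha0] := left_end.
(* Strictly below a0, so that a whole neighbourhood of a carries no density. *)
pose a := Num.min a0 tau - 1.
have a_lt : a < a0 /\ a < tau.
  have h1 : Num.min a0 tau <= a0 by rewrite ge_min lexx.
  have h2 : Num.min a0 tau <= tau by rewrite ge_min lexx orbT.
  by rewrite /a; split; lra.
have na : ~ supp (scdos M) a.
  move=> /(_ [set y | y < a0]) [|y [/= sy ya]]; first exact: (lt_nbhsl a_lt.1).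
  by move: sy; rewrite (ha0 y (ltW ya)).1 eqxx.
have [U UU hr] := potential_right (dMr ntau) (scdos_off_supp ntau).
have hl := potential_left (dMr na) (scdos_off_supp na) ((ha0 a (ltW a_lt.1)).2 U UU).
have -> : (\int[lebesgue_measure]_(x in `]-oo, tau]) (scdos M x)%:E
   = \int[lebesgue_measure]_(x in `[a, tau]) (scdos M x)%:E)%E.
  have -> : `[a, tau]%classic = `]-oo, tau]%classic `&` `[a, +oo[%classic.
    apply/seteqP; split => x /=; rewrite !in_itv /= ?andbT.
      by move=> /andP[].
    by move=> [-> ->].
  rewrite integral_mkcondr; apply: eq_integral => x _.
  rewrite patchE; case: ifPn => // /negP; rewrite inE /= in_itv /= andbT => /negP.
  rewrite -ltNge => xa; rewrite (ha0 x _).1 //.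
  by apply/ltW/(lt_trans xa); exact: a_lt.1.
rewrite (scdos_integral UU a_lt.2 hl hr) subr0; congr (_%:E).
have pin0 : pi != 0 :> R by rewrite gt_eqF // pi_gt0.
by rewrite invfM mulrACA mulVf // mul1r mulrC.
Qed.

End BandMass.

(** The density is a limit from the upper half-plane, so it does not see the
    values of [M] elsewhere. *)
Lemma scdos_eq (R : realType) (N : nat) (M M' : R[i] -> 'M[R[i]]_N) :
  (forall z, 0 < complex.Im z -> M' z = M z) -> scdos M' = scdos M.
Proof.
move=> MM; apply/funext => x; rewrite /scdos; congr lim.
have e : \forall eta \near (0 : R)^'+,
    scdos_upper M' (x +i* eta) = scdos_upper M (x +i* eta).
  near=> eta; have eta0 : 0 < eta by near: eta; exact: nbhs_right_gt.
  by rewrite /scdos_upper MM.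
rewrite eqEsubset; split; apply: near_eq_cvg => //.
by apply: filterS e.
Unshelve. all: by end_near. Qed.

Theorem proposition5p1 (R : realType) (N : nat) (hN : (0 < N)%N)
  (d : measure_display) (Omega : measurableType d) (P : probability Omega R)
  (W : Omega -> 'M[R[i]]_N) (A : 'M[R[i]]_N) (c C : R)
  (hA : A \is hermsymmx)
  (hW : forall w, W w \is hermsymmx)
  (hW2 : square_integrable_mx P W)
  (hEW : mxexpectation P W = 0)
  (hc : 0 < c) (hcC : c < C)
  (hbounded : opnorm A <= C)
  (hflat : flat (self_energy P W) c C)
  (M : R[i] -> 'M[R[i]]_N)
  (hM : forall z, 0 < complex.Im z -> mde_solution A (self_energy P W) z (M z))
  (Mext : R[i] -> 'M[R[i]]_N) (hMext : analytic_extension M Mext)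
  (tau : R) (htau : ~ supp (scdos M) tau) :
  (\int[lebesgue_measure]_(x in `]-oo, tau]) (scdos M x)%:E
     = ((num_neg_eigenvalues (Mext tau%:C))%:R / N%:R)%:E)%E /\
  exists k : int,
    (N%:R%:E * \int[lebesgue_measure]_(x in `]-oo, tau]) (scdos M x)%:E
     = (k%:~R)%:E)%E.
Proof.
have [w Sw] := self_energy_kraus hW hW2.
have SE : self_energy P W = kraus w by apply/funext.
have htr := self_energy_trace hW2; rewrite SE in htr hflat hM.
have [holo ext] := hMext.
rewrite -(scdos_eq ext) in holo htau *.
have hMe z : 0 < complex.Im z -> mde_solution A (kraus w) z (Mext z).
  by move=> z0; rewrite ext //; exact: hM.
have dM z : 0 < complex.Im z -> forall i j,
    derivable (fun w : R[i]^o => Mext w i j : R[i]^o) z 1.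
  by move=> z0 i j; apply: holo => -[y _ yz]; move: z0; rewrite -yz ltxx.
have dMr x : ~ supp (scdos Mext) x -> forall i j,
    derivable (fun w : R[i]^o => Mext w i j : R[i]^o) x%:C 1.
  by move=> nx i j; apply: holo => -[y sy [yx]]; apply: nx; rewrite -yx.
have mass := band_mass hN (elimT (hermP _) hA) hc (lt_trans hc hcC) hflat htr hMe dM dMr htau.
split; first exact: mass.
exists (Posz (num_neg_eigenvalues (Mext tau%:C))).
rewrite mass -EFinM; congr (_%:E); rewrite mulrCA divff ?mulr1 //.
by rewrite pnatr_eq0 -lt0n.
Qed.
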